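(* Let $n\ge1$ and let $\Phi=\Phi_-^*+\Phi_+\in L^\infty_{M_n}$ be a matrix-valued rational function. Write $$\Phi_-=B^*\Theta,$$ where $\Theta:=\theta I_n$ with $\theta$ a finite Blaschke product and $B\in H^2_{M_n}$. Assume that $B(\alpha)$ is invertible for each zero $\alpha\in\mathbb D$ of $\theta$. If $T_\Phi$ is subnormal then $T_\Phi$ is normal or analytic.
   Context: $H^2_{\mathbb C^n}$ is the $\mathbb C^n$-valued Hardy space on the unit circle $\mathbb T$; $L^\infty_{M_n}$, $H^\infty_{M_n}$, $H^2_{M_n}$ are the $n\times n$ matrix functions with entries in $L^\infty(\mathbb T)$, $H^\infty$, $H^2$. A matrix function is rational if each entry is a rational function. $\Phi^*$ is the pointwise adjoint. $P_n$ is the orthogonal projection of $L^2_{\mathbb C^n}$ onto $H^2_{\mathbb C^n}$ (applied columnwise to matrix functions), $P_n^\perp=I-P_n$. $\Phi_+:=P_n\Phi\in H^2_{M_n}$ and $\Phi_-:=(P_n^\perp\Phi)^*\in H^2_{M_n}$, so $\Phi=\Phi_-^*+\Phi_+$. The block Toeplitz operator $T_\Phi$ on $H^2_{\mathbb C^n}$ is $T_\Phi F=P_n(\Phi F)$; it is called analytic if $\Phi\in H^\infty_{M_n}$. An operator is subnormal if it is the restriction of a normal operator (on a larger Hilbert space) to an invariant subspace. *)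

(* Defs.v *)
From HB Require Import structures.
From mathcomp Require Import all_boot all_order all_algebra.
From mathcomp Require Import sesquilinear complex generic_quotient ring_quotient.
From mathcomp Require Import all_classical all_reals all_analysis.
From mathcomp Require Import ess_sup_inf measurable_realfun.

Set Implicit Arguments.
Unset Strict Implicit.
Unset Printing Implicit Defensive.

Import Order.TTheory GRing.Theory Num.Theory.
Import numFieldNormedType.Exports.

Local Open Scope classical_set_scope.
Local Open Scope quotient_scope.
Local Open Scope ring_scope.

Section Operators.
Variable R : realType.
Local Notation C := R[i].

(* The order of R[i] only compares complex numbers with equal imaginary parts:
   a complex e with 0 < e is a positive real. *)
Definition hilbert (H : lmodType C) (ip : {dot H for Num.conj}) : Prop :=
  forall u : nat -> H,
    (forall e : C, 0 < e -> exists N, forall m k, (N <= m)%N -> (N <= k)%N ->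
       ip (u m - u k) (u m - u k) < e) ->
    exists l : H, forall e : C, 0 < e -> exists N, forall m, (N <= m)%N ->
       ip (u m - l) (u m - l) < e.

Definition bounded_operator (H : lmodType C) (ip : {dot H for Num.conj})
    (T : H -> H) : Prop :=
  linear T /\ exists M : C, forall x, ip (T x) (T x) <= M * ip x x.

Definition is_adjoint (H : lmodType C) (ip : {dot H for Num.conj})
    (T S : H -> H) : Prop :=
  forall x y, ip (T x) y = ip x (S y).

(* The relation is_adjoint determines S, as the form is definite. *)
Definition normal_operator (H : lmodType C) (ip : {dot H for Num.conj})
    (T : H -> H) : Prop :=
  bounded_operator ip T /\
  exists S : H -> H, is_adjoint ip T S /\ forall x, S (T x) = T (S x).

(* H is identified with its image under the isometric embedding V; the image
   is invariant under N because N (V x) = V (T x). *)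
Definition subnormal_operator (H : lmodType C) (ip : {dot H for Num.conj})
    (T : H -> H) : Prop :=
  exists (K : lmodType C) (ipK : {dot K for Num.conj}),
    hilbert ipK /\
    exists (V : {linear H -> K}) (N : K -> K),
      [/\ isometry ipK ip V, normal_operator ipK N &
          forall x, N (V x) = V (T x)].

End Operators.

Section Circle.
Variable R : realType.
Local Notation C := R[i].

Definition cis (t : R) : C := (cos t +i* sin t)%C.

Lemma two_pi_gt0 : 0 < pi *+ 2 :> R.
Proof. by rewrite pmulrn_lgt0 // pi_gt0. Qed.

(* Functions on the unit circle are functions on R[i] looked at through cis
   only; circ is normalized arc length in the angle t. *)
Definition circ : probability (measurableTypeR R) R := uniform_prob two_pi_gt0.

(* |f| is in L^p iff the real and imaginary parts of f are. *)
Definition Lcirc (p : \bar R) : {pred C -> C} := fun f =>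
  ((fun t => complex.Re (f (cis t))) \in Lfun circ p) &&
  ((fun t => complex.Im (f (cis t))) \in Lfun circ p).

Lemma eq_Lcirc p f g : f =1 g -> f \in Lcirc p -> g \in Lcirc p.
Proof. by move=> /funext ->. Qed.

Definition circ_int (f : C -> C) : C :=
  ((\int[circ]_t complex.Re (f (cis t))) +i* (\int[circ]_t complex.Im (f (cis t))))%C.

Lemma eq_Lfun p (u v : R -> R) :
  u =1 v -> u \in Lfun circ p -> v \in Lfun circ p.
Proof. by move=> /funext ->. Qed.

Lemma Lfun_lin p (x : R) (u v : R -> R) : (1 <= p)%E ->
  u \in Lfun circ p -> v \in Lfun circ p ->
  (fun t => x * u t + v t) \in Lfun circ p.
Proof. by move=> p1; have [_] := @Lfun_submod_closed _ _ _ circ p p1; exact. Qed.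

Lemma Lcirc_submod p : (1 <= p)%E -> forall (a : C) f g,
  f \in Lcirc p -> g \in Lcirc p -> (fun z => a * f z + g z) \in Lcirc p.
Proof.
move=> p1 a f g /andP[f1 f2] /andP[g1 g2].
have h (x y : R) u v w : u \in Lfun circ p -> v \in Lfun circ p ->
    w \in Lfun circ p -> (fun t => x * u t + (y * v t + w t)) \in Lfun circ p.
  by move=> uL vL wL; exact: (Lfun_lin x p1 uL (Lfun_lin y p1 vL wL)).
apply/andP; split.
  apply: eq_Lfun (h (complex.Re a) (- complex.Im a) _ _ _ f1 f2 g1) => t /=; case: a => ? ?; case: (f _) => ? ?; case: (g _) => ? ? /=.
  by rewrite addrA mulNr.
apply: eq_Lfun (h (complex.Re a) (complex.Im a) _ _ _ f2 f1 g2) => t /=; case: a => ? ?; case: (f _) => ? ?; case: (g _) => ? ? /=.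
by rewrite addrA.
Qed.

Lemma Lcirc0 p : (1 <= p)%E -> (fun=> 0) \in Lcirc p.
Proof.
by move=> p1; have [h0 _] := @Lfun_submod_closed _ _ _ circ p p1; apply/andP.
Qed.

Lemma Lcirc_conj p f : (1 <= p)%E -> f \in Lcirc p ->
  (fun z => (f z)^*) \in Lcirc p.
Proof.
move=> p1 /andP[f1 f2]; have [h0 _] := @Lfun_submod_closed _ _ _ circ p p1.
apply/andP; split.
  by apply: eq_Lfun f1 => t /=; case: (f _).
apply: eq_Lfun (Lfun_lin (-1) p1 f2 h0) => t; rewrite ?fctE /=; case: (f _) => ? ? /=.
by rewrite addr0 mulN1r.
Qed.

Lemma Lcirc_mul f g : f \in Lcirc 2%:E -> g \in Lcirc 2%:E ->
  (fun z => f z * g z) \in Lcirc 1.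
Proof.
move=> /andP[f1 f2] /andP[g1 g2].
have M u v : u \in Lfun circ 2%:E -> v \in Lfun circ 2%:E ->
   (u \* v) \in Lfun circ 1 by exact: Lfun2_mul_Lfun1.
apply/andP; split.
  apply: eq_Lfun (Lfun_lin (-1) (lexx _) (M _ _ f2 g2) (M _ _ f1 g1)) => t; rewrite ?fctE /=; case: (f _) => ? ?; case: (g _) => ? ? /=.
  by rewrite mulN1r addrC.
apply: eq_Lfun (Lfun_lin 1 (lexx _) (M _ _ f1 g2) (M _ _ f2 g1)) => t; rewrite ?fctE /=; case: (f _) => ? ?; case: (g _) => ? ? /=.
by rewrite mul1r.
Qed.

Lemma Lcirc21 f : f \in Lcirc 2%:E -> f \in Lcirc 1.
Proof.
have h : {subset Lfun circ 2%:E <= Lfun circ 1}.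
  by apply: Lfun_subset12; exact: fin_num_measure.
by move=> /andP[f1 f2]; apply/andP; split; apply: h.
Qed.

Lemma circ_intP (a : C) f g : f \in Lcirc 1 -> g \in Lcirc 1 ->
  circ_int (fun z => a * f z + g z) = a * circ_int f + circ_int g.
Proof.
move=> /andP[/Lfun1_integrable f1 /Lfun1_integrable f2].
move=> /andP[/Lfun1_integrable g1 /Lfun1_integrable g2].
have Z u (x : R) : circ.-integrable setT (EFin \o u) ->
   circ.-integrable setT (EFin \o (fun t => x * u t)).
  move=> iu.
  have := integrableZl measurableT x iu.
  by apply: eq_integrable => // t _.
have D (x y : R) u v w : circ.-integrable setT (EFin \o u) ->
    circ.-integrable setT (EFin \o v) -> circ.-integrable setT (EFin \o w) ->
    \int[circ]_t (x * u t + y * v t + w t) =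
    x * (\int[circ]_t u t) + y * (\int[circ]_t v t) + \int[circ]_t w t.
  move=> iu iv iw; rewrite RintegralD //; last first.
    have := integrableD measurableT (Z _ x iu) (Z _ y iv).
    by apply: eq_integrable => // t _.
  by rewrite RintegralD // ?RintegralZl //; exact: Z.
rewrite /circ_int /=.
transitivity ((\int[circ]_t (complex.Re a * complex.Re (f (cis t)) + (- complex.Im a) * complex.Im (f (cis t)) + complex.Re (g (cis t))))
  +i* (\int[circ]_t (complex.Re a * complex.Im (f (cis t)) + complex.Im a * complex.Re (f (cis t)) + complex.Im (g (cis t)))))%C.
  congr Complex; apply: eq_Rintegral => t _;
   case: a => ? ?; case: (f _) => ? ?; case: (g _) => ? ? //=.
  by rewrite mulNr.
rewrite !D //; case: a => ar ai.
set x := Rintegral _ _ _; set y := Rintegral _ _ _; set z := Rintegral _ _ _.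
set w := Rintegral _ _ _.
by rewrite /= mulNr.
Qed.

Lemma circ_int_conj f : f \in Lcirc 1 ->
  circ_int (fun z => (f z)^*) = (circ_int f)^*.
Proof.
move=> /andP[/Lfun1_integrable f1 /Lfun1_integrable f2].
rewrite /circ_int; apply/eqP; rewrite eq_complex /=; apply/andP; split; apply/eqP.
  by apply: eq_Rintegral => t _; case: (f _).
rewrite -mulN1r -RintegralZl //; apply: eq_Rintegral => t _.
by case: (f _) => ? ? /=; rewrite mulN1r.
Qed.

Lemma Lcirc_sum p n (f : 'I_n -> C -> C) : (1 <= p)%E ->
  (forall i, f i \in Lcirc p) -> (fun z => \sum_i f i z) \in Lcirc p.
Proof.
move=> p1; elim: n f => [|n IH] f fL.
  by apply: eq_Lcirc (Lcirc0 p1) => z; rewrite big_ord0.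
have := Lcirc_submod p1 1 (fL ord0) (IH (fun i => f (lift ord0 i)) _).
move=> /(_ (fun i => fL _)); apply: eq_Lcirc => z.
by rewrite mul1r big_ord_recl.
Qed.

Lemma circ_int_ae f g : f \in Lcirc 1 -> g \in Lcirc 1 ->
  {ae circ, forall t, f (cis t) = g (cis t)} -> circ_int f = circ_int g.
Proof.
move=> /andP[/Lfun1_integrable f1 /Lfun1_integrable f2].
move=> /andP[/Lfun1_integrable g1 /Lfun1_integrable g2] fg.
have h u v : circ.-integrable setT (EFin \o u) ->
    circ.-integrable setT (EFin \o v) -> {ae circ, forall t, u t = v t} ->
    \int[circ]_t u t = \int[circ]_t v t.
  move=> iu iv uv; congr fine; apply: ae_eq_integral => //.
  - exact: measurable_int iu.
  - exact: measurable_int iv.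
  apply: (@filterS _ _ (ae_filter_ringOfSetsType circ) _ _ _ uv).
  by move=> t /= ->.
by congr Complex; apply: h => //;
  apply: (@filterS _ _ (ae_filter_ringOfSetsType circ) _ _ _ fg) => t /= ->.
Qed.

Lemma cisX t m : cis t ^+ m = cis (m%:R * t).
Proof.
elim: m => [|m IH]; first by rewrite expr0 mul0r /cis cos0 sin0.
rewrite exprS IH -natr1 mulrDl mul1r addrC /cis cosD sinD.
by apply/eqP; rewrite eq_complex /= [sin t * _ + _]addrC !eqxx.
Qed.

Lemma Lfun_bounded p (u : R -> R) : (1 <= p)%E -> measurable_fun setT u ->
  (forall t, `|u t| <= 1) -> u \in Lfun circ p.
Proof.
move=> p1 mu ub.
suff : u \in Lfun circ +oo%E.
  apply: Lfun_subset => //; first exact: (le_trans p1 (leey _)).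
    exact: fin_num_measure.
  exact: leey.
apply/andP; split; rewrite inE //= /finite_norm unlock.
case: ifP => // _; apply: (@le_lt_trans _ _ 1%E); last exact: ltry.
apply/ess_supP/aeW => t /=; rewrite lee_fin; exact: ub.
Qed.

Lemma Lcirc_exp p m : (1 <= p)%E -> (fun z : C => z ^+ m) \in Lcirc p.
Proof.
move=> p1; apply/andP; split.
  apply: (@eq_Lfun _ (fun t => cos (m%:R * t))) => [t|].
    by rewrite cisX.
  apply: Lfun_bounded => // [|t]; last exact: cos_max.
  apply: measurableT_comp; last exact: mulrl_measurable.
  by apply: continuous_measurable_fun; exact: continuous_cos.
apply: (@eq_Lfun _ (fun t => sin (m%:R * t))) => [t|].
  by rewrite cisX.
apply: Lfun_bounded => // [|t]; last exact: sin_max.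
apply: measurableT_comp; last exact: mulrl_measurable.
by apply: continuous_measurable_fun; exact: continuous_sin.
Qed.

Definition fourier_coef (f : C -> C) (k : int) : C :=
  circ_int (fun z => f z * z ^ (- k)).

(* The Hardy space H^p of the circle, for p = 2 and p = +oo. *)
Definition hardy (p : \bar R) : {pred C -> C} := fun f =>
  (f \in Lcirc p) && `[< forall k : int, k < 0 -> fourier_coef f k = 0 >].

End Circle.

Section SquareIntegrable.
Variables (R : realType) (n : nat).
Local Notation C := R[i].
Local Notation circ := (circ R).

Definition ae_eq_circ (T : Type) (f g : C -> T) : Prop :=
  {ae circ, forall t : R, f (cis t) = g (cis t)}.

Lemma ae_circ2 (P Q S : R -> Prop) : (forall t, P t -> Q t -> S t) ->
  {ae circ, forall t, P t} -> {ae circ, forall t, Q t} ->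
  {ae circ, forall t, S t}.
Proof.
move=> PQS aeP aeQ.
exact: (@filterS2 _ _ (ae_filter_ringOfSetsType circ) _ _ _ PQS aeP aeQ).
Qed.

Lemma ae_circ_sym T (f g : C -> T) : ae_eq_circ f g -> ae_eq_circ g f.
Proof. by move=> h; apply: ae_circ2 (h) (h) => t ->. Qed.

Lemma ae_circ_trans T (f g h : C -> T) :
  ae_eq_circ f g -> ae_eq_circ g h -> ae_eq_circ f h.
Proof. by apply: ae_circ2 => t ->. Qed.

Definition L2pred : {pred C -> 'cV[C]_n} := fun f =>
  [forall i, (fun z => f z i 0) \in Lcirc 2%:E].

Lemma L2pred_submod : submod_closed L2pred.
Proof.
split.
  apply/forallP => i.
  by apply: eq_Lcirc (Lcirc0 (lee1n 2)) => z; rewrite mxE.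
move=> a f g /forallP fL /forallP gL; apply/forallP => i.
have := Lcirc_submod (lee1n 2) a (fL i) (gL i).
apply: eq_Lcirc => z; by rewrite !mxE.
Qed.

HB.instance Definition _ := GRing.isSubmodClosed.Build C (C -> 'cV[C]_n) L2pred
  L2pred_submod.

Record sqfun := Sqfun { sqfun_fun :> C -> 'cV[C]_n; _ : sqfun_fun \in L2pred }.
HB.instance Definition _ := [isSub for sqfun_fun].
HB.instance Definition _ := [Choice of sqfun by <:].
HB.instance Definition _ := [SubChoice_isSubLmodule of sqfun by <:].

Lemma sqfunP a (f g : sqfun) z : (a *: f + g) z = a *: f z + g z.
Proof. by []. Qed.

Lemma sqfunB (f g : sqfun) z : (f - g) z = f z - g z.
Proof. by []. Qed.

Definition null_sqfun : {pred sqfun} := fun f => `[< ae_eq_circ f (fun=> 0) >].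

Lemma null_sqfun_submod : submod_closed null_sqfun.
Proof.
split.
  by apply/asboolP; apply/aeW => t.
move=> a f g /asboolP fN /asboolP gN; apply/asboolP.
by apply: ae_circ2 fN gN => t f0 g0; rewrite sqfunP f0 g0 scaler0 addr0.
Qed.

HB.instance Definition _ := GRing.isSubmodClosed.Build C sqfun null_sqfun
  null_sqfun_submod.

(* L^2 of the circle with values in C^n: square-integrable functions modulo
   equality almost everywhere. *)
Definition L2 : Type := Quotient.quot null_sqfun.
HB.instance Definition _ := GRing.Zmodule.on L2.
HB.instance Definition _ := EqQuotient.on L2.

Definition sqfun_class (f : sqfun) : L2 := \pi_L2 f.

Definition L2repr (F : L2) : sqfun := repr F.

Lemma L2reprK : cancel L2repr sqfun_class.
Proof. exact: reprK. Qed.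

Lemma sqfun_classP (f g : sqfun) :
  sqfun_class f = sqfun_class g <-> ae_eq_circ f g.
Proof.
have -> : (sqfun_class f = sqfun_class g) <-> (f == g %[mod L2]).
  by split=> /eqP.
rewrite -Quotient.idealrBE; split=> [/asboolP|fg]; last apply/asboolP.
  by apply: ae_circ2 (aeW _ (fun=> I)) => t _; rewrite sqfunB => /subr0_eq.
by apply: ae_circ2 (fg) (fg) => t fgt _; rewrite sqfunB fgt subrr.
Qed.

Lemma sqfun_classD f g : sqfun_class (f + g) = sqfun_class f + sqfun_class g.
Proof. exact: Quotient.pi_add. Qed.

Definition L2scale (a : C) (F : L2) : L2 := sqfun_class (a *: L2repr F).

Lemma sqfun_classZ a f : L2scale a (sqfun_class f) = sqfun_class (a *: f).
Proof.
apply/sqfun_classP.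
have /sqfun_classP h : sqfun_class (L2repr (sqfun_class f)) = sqfun_class f.
  by rewrite L2reprK.
by apply: ae_circ2 (h) (h) => t ht _; exact: (congr1 ( *:%R a) ht).
Qed.

Lemma L2scaleA a b F : L2scale a (L2scale b F) = L2scale (a * b) F.
Proof. by rewrite -[F]L2reprK (sqfun_classZ b) !sqfun_classZ scalerA. Qed.

Lemma L2scale1 : left_id 1 L2scale.
Proof. by move=> F; rewrite -[F]L2reprK sqfun_classZ scale1r. Qed.

Lemma L2scaleDr : right_distributive L2scale +%R.
Proof.
move=> a F G; rewrite -[F]L2reprK -[G]L2reprK -sqfun_classD !sqfun_classZ.
by rewrite -sqfun_classD scalerDr.
Qed.

Lemma L2scaleDl F : {morph L2scale^~ F : a b / a + b}.
Proof.
by move=> a b; rewrite -[F]L2reprK !sqfun_classZ -sqfun_classD scalerDl.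
Qed.

HB.instance Definition _ := GRing.Zmodule_isLmodule.Build C L2
  L2scaleA L2scale1 L2scaleDr L2scaleDl.

Definition L2fun (F : L2) : C -> 'cV[C]_n := L2repr F.

(* The class of f; it is 0 by convention when f is not square-integrable. *)
Definition L2class (f : C -> 'cV[C]_n) : L2 := sqfun_class (insubd (0 : sqfun) f).

Lemma L2fun_L2 F i : (fun z => L2fun F z i 0) \in Lcirc 2%:E.
Proof. by have /forallP := valP (L2repr F); exact. Qed.

Lemma L2funP a F G :
  ae_eq_circ (L2fun (a *: F + G)) (fun z => a *: L2fun F z + L2fun G z).
Proof.
have : sqfun_class (L2repr (a *: F + G)) =
    sqfun_class (a *: L2repr F + L2repr G).
  by rewrite sqfun_classD -sqfun_classZ !L2reprK.
by move/sqfun_classP.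
Qed.


Definition L2ip (F G : L2) : C :=
  circ_int (fun z => \sum_i L2fun F z i 0 * (L2fun G z i 0)^*).

Lemma L2ip_Lcirc F G :
  (fun z => \sum_i L2fun F z i 0 * (L2fun G z i 0)^*) \in Lcirc 1.
Proof.
apply: Lcirc_sum => // i; apply: Lcirc_mul; first exact: L2fun_L2.
by apply: Lcirc_conj; [exact: (lee1n 2) | exact: L2fun_L2].
Qed.

Lemma L2ip_linearl (K : L2) : GRing.linear_for *%R (L2ip^~ K).
Proof.
move=> a F G; rewrite /L2ip -circ_intP; [|exact: L2ip_Lcirc..].
apply: circ_int_ae; first exact: L2ip_Lcirc.
  by apply: Lcirc_submod => //; exact: L2ip_Lcirc.
apply: ae_circ2 (L2funP a F G) (L2funP a F G) => t -> _.
rewrite mulr_sumr -big_split; apply: eq_bigr => i _ /=.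
by rewrite !mxE mulrDl mulrA.
Qed.

Lemma L2ip_herm F G : L2ip F G = (-1) ^+ false * (L2ip G F)^*.
Proof.
rewrite expr0 mul1r -circ_int_conj; last exact: L2ip_Lcirc.
congr circ_int; apply/funext => z; rewrite rmorph_sum; apply: eq_bigr => i _.
rewrite rmorphM mulrC; congr (_ * _); exact: (esym (conjCK _)).
Qed.

Lemma L2ip_linearr (K : L2) : GRing.linear_for (Num.conj \; *%R) (L2ip K).
Proof.
move=> a F G; rewrite !(L2ip_herm K) !expr0 !mul1r L2ip_linearl.
by rewrite rmorphD rmorphM.
Qed.

HB.instance Definition _ := @bilinear_isBilinear.Build C L2 L2 C _ _ L2ip
  (L2ip_linearl, L2ip_linearr).
HB.instance Definition _ := @isHermitianSesquilinear.Build C L2 false Num.conj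
  L2ip L2ip_herm.

Lemma L2ip_gt0 F : F != 0 -> 0 < L2ip F F.
Proof.
move=> F0; pose r z : R := \sum_i (complex.Re (L2fun F z i 0) ^+ 2
                                 + complex.Im (L2fun F z i 0) ^+ 2).
have rE z : \sum_i L2fun F z i 0 * (L2fun F z i 0)^* = (r z)%:C%C.
  rewrite /r rmorph_sum; apply: eq_bigr => i _; case: (L2fun F z i 0) => x y.
  apply/eqP; rewrite eq_complex /= !mulrN opprK !expr2 eqxx /=.
  by rewrite [y * x]mulrC addNr.
have r0 z : 0 <= r z.
  by apply: sumr_ge0 => i _; rewrite addr_ge0 // sqr_ge0.
have ir : circ.-integrable setT (EFin \o (r \o (@cis R))).
  have /andP[/Lfun1_integrable + _] := L2ip_Lcirc F F.
  by apply: eq_integrable => // t _ /=; rewrite rE.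
have -> : L2ip F F = (\int[circ]_t r (cis t))%:C%C.
  rewrite /L2ip /circ_int; apply/eqP; rewrite eq_complex /=; apply/andP; split.
    by apply/eqP; apply: eq_Rintegral => t _; rewrite rE.
  apply/eqP; transitivity (\int[circ]_t (0 : R)).
    by apply: eq_Rintegral => t _; rewrite rE.
  by rewrite /Rintegral integral0.
rewrite ltcR lt_def Rintegral_ge0 ?andbT //.
apply: contra F0 => /eqP int0.
rewrite -[F]L2reprK -[0]L2reprK; apply/eqP/sqfun_classP.
have : ae_eq circ setT (EFin \o (r \o (@cis R))) (cst 0%E).
  apply/ae_eq_integral_abs => //; first exact: measurable_int ir.
  under eq_integral do rewrite /= ger0_norm //.
  by rewrite -[LHS]fineK ?(integrable_fin_num _ ir) //; congr EFin.
have zero0 : ae_eq_circ (L2repr 0) (fun=> 0).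
  have /sqfun_classP // : sqfun_class (L2repr 0) = sqfun_class 0.
  rewrite L2reprK; apply: (addrI (sqfun_class 0)).
  by rewrite -sqfun_classD !addr0.
move=> r_ae; apply: (@ae_circ_trans _ _ (fun=> 0)); last exact: ae_circ_sym.
apply: ae_circ2 (r_ae) (r_ae) => t /(_ I) /= [rt0] _.
apply/matrixP => i j; rewrite ord1 mxE.
move: rt0 => /eqP; rewrite /r psumr_eq0; last first.
  by move=> k _; rewrite addr_ge0 // sqr_ge0.
move=> /allP /(_ i (mem_index_enum _)) /=.
rewrite paddr_eq0 ?sqr_ge0 // !sqrf_eq0 => /andP[/eqP x0 /eqP y0].
by apply/eqP; rewrite eq_complex; apply/andP; split; apply/eqP.
Qed.
HB.instance Definition _ := @isDotProduct.Build C L2 L2ip L2ip_gt0.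

End SquareIntegrable.

Section HardySpace.
Variables (R : realType) (n : nat).
Local Notation C := R[i].
Local Notation L2 := (L2 R n).

Definition hardy_L2 : {pred L2} := fun F =>
  [forall i, (fun z => L2fun F z i 0) \in hardy 2%:E].

Lemma hardy_L2_submod : submod_closed hardy_L2.
Proof.
have coefM f (k : int) : k < 0 -> f \in Lcirc 2%:E ->
    (fun z : C => f z * z ^ (- k)) \in Lcirc 1.
  case: k => // m _ fL; apply: Lcirc_mul => //.
  by apply: eq_Lcirc (Lcirc_exp m.+1 (lee1n 2)) => z; rewrite NegzE opprK.
have key a (F G : L2) i (k : int) : k < 0 ->
    fourier_coef (fun z => L2fun (a *: F + G) z i 0) k =
    a * fourier_coef (fun z => L2fun F z i 0) k +
    fourier_coef (fun z => L2fun G z i 0) k.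
  move=> k0; rewrite /fourier_coef -circ_intP; try exact: coefM (L2fun_L2 _ _).
  apply: circ_int_ae; first exact: coefM (L2fun_L2 _ _).
    by apply: Lcirc_submod => //; exact: coefM (L2fun_L2 _ _).
  apply: ae_circ2 (L2funP a F G) (L2funP a F G) => t -> _.
  by rewrite !mxE mulrDl mulrA.
split.
  apply/forallP => i; apply/andP; split; first exact: L2fun_L2.
  apply/asboolP => k k0.
  have := key (-1) 0 0 i k k0.
  by rewrite scaler0 addr0 mulN1r addNr.
move=> a F G /forallP FH /forallP GH; apply/forallP => i.
apply/andP; split; first exact: L2fun_L2.
have /andP[_ /asboolP FHi] := FH i; have /andP[_ /asboolP GHi] := GH i.
by apply/asboolP => k k0; rewrite key // FHi // GHi // mulr0 addr0.
Qed.

HB.instance Definition _ := GRing.isSubmodClosed.Build C L2 hardy_L2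
  hardy_L2_submod.

Record H2 := MkH2 { H2val :> L2; _ : H2val \in hardy_L2 }.
HB.instance Definition _ := [isSub for H2val].
HB.instance Definition _ := [Choice of H2 by <:].
HB.instance Definition _ := [SubChoice_isSubLmodule of H2 by <:].

Definition H2ip (F G : H2) : C := L2ip F G.

Lemma H2ip_linearl (K : H2) : GRing.linear_for *%R (H2ip^~ K).
Proof. by move=> a F G; exact: L2ip_linearl. Qed.

Lemma H2ip_linearr (K : H2) : GRing.linear_for (Num.conj \; *%R) (H2ip K).
Proof. by move=> a F G; exact: L2ip_linearr. Qed.

Lemma H2ip_herm F G : H2ip F G = (-1) ^+ false * (H2ip G F)^*.
Proof. exact: L2ip_herm. Qed.

Lemma H2ip_gt0 F : F != 0 -> 0 < H2ip F F.
Proof. by move=> F0; apply: L2ip_gt0. Qed.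

HB.instance Definition _ := @bilinear_isBilinear.Build C H2 H2 C _ _ H2ip
  (H2ip_linearl, H2ip_linearr).
HB.instance Definition _ := @isHermitianSesquilinear.Build C H2 false Num.conj
  H2ip H2ip_herm.
HB.instance Definition _ := @isDotProduct.Build C H2 H2ip H2ip_gt0.

(* Orthogonal projection onto the Hardy space: the element G of H2 such that
   F - G is orthogonal to H2. *)
Definition hardy_proj (F : L2) : H2 :=
  xget 0 [set G | forall K : H2, L2ip (F - H2val G) (H2val K) = 0].

Definition toeplitz (Phi : C -> 'M[C]_n) (F : H2) : H2 :=
  hardy_proj (L2class (fun z => Phi z *m L2fun F z)).

Definition adjmx (A : 'M[C]_n) : 'M[C]_n := map_mx Num.conj A^T.

(* (P^perp Phi)^*, the projection acting on each column of Phi. *)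
Definition minus_part (Phi : C -> 'M[C]_n) (z : C) : 'M[C]_n :=
  let co_analytic j :=
    let F := L2class (fun w => col j (Phi w)) in F - H2val (hardy_proj F) in
  adjmx (\matrix_(i, j) L2fun (co_analytic j) z i 0).

Definition L_mx (p : \bar R) (Phi : C -> 'M[C]_n) : Prop :=
  forall i j, (fun z => Phi z i j) \in Lcirc p.

Definition hardy_mx (p : \bar R) (Phi : C -> 'M[C]_n) : Prop :=
  forall i j, (fun z => Phi z i j) \in hardy p.

Definition rational_mx (Phi : C -> 'M[C]_n) : Prop :=
  forall i j, exists p q : {poly C},
    q != 0 /\ ae_eq_circ (fun z => Phi z i j) (fun z => p.[z] / q.[z]).

(* The value at a point alpha of the open unit disc of the holomorphic extension
   of B, by Cauchy's formula: (2 pi i)^-1 times the contour integral of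
   B(z) / (z - alpha) dz, with dz = i z dt. *)
Definition hardy_eval (B : C -> 'M[C]_n) (alpha : C) : 'M[C]_n :=
  \matrix_(i, j) circ_int (fun z => B z i j / (1 - alpha / z)).

End HardySpace.

(* The empty product is allowed. *)
Definition finite_blaschke (R : realType) (theta : R[i] -> R[i]) : Prop :=
  exists (c : R[i]) (s : seq R[i]),
    [/\ `|c| = 1, (forall a, a \in s -> `|a| < 1) &
        forall z, `|z| <= 1 ->
          theta z = c * \prod_(a <- s) ((z - a) / (1 - a^* * z))].

(* Main.v *)
(* Write T for the Toeplitz operator of Phi, M and M' for multiplication by Phi
   and Phi^* on L^2, and H for the Hardy space. Subnormality is used through
   one fact only: T is hyponormal, and the space E of the vectors f with
   |T^* f| = |T f| is T-invariant, with T^* T = T T^* on E; so it is enough to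
   show E = H.

   Hyponormality makes |M f|^2 - |M' f|^2 nonnegative on H, and its trace over
   the matrix units vanishes, so |M f| = |M' f| on H. Comparing projections, E
   contains every f in H with M' f in H, and conversely f in E and M f in H
   imply M' f in H.

   Let t be the product of the z - a over the zeros a of theta. Then t Phi
   maps H into H, and its value at each zero is a nonzero multiple of B(a),
   hence invertible. Some polynomial d with zeros in the disc satisfies
   d M' H <= H, hence d H <= E. Write d = d1 d2 with d1 dividing a power of t
   and d2 prime to t.
   - H = (t Phi) H + t H, so t^(j+1) d2 H <= E implies t^j d2 H <= E, and
     therefore d2 H <= E.
   - If e = d2 g + t h is in E, then so is t h, hence M' (t h) is in H and z t h
     is in E; thus z E <= E.
   - If a is a zero of t and t = (z - a) t', applying T to the vector
     d2 t' c' of E gives (q - q(a)) / (z - a), where q = d2 (t Phi) c'. As q is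
     in d2 H <= E, so is the constant q(a), which is arbitrary; so E contains
     the constants, and E = H.
   When theta has no zero, t = 1 and t Phi H <= H says that Phi is analytic.

   Evaluations, divisions by z - a and projections are only needed for rational
   symbols, where they are explicit; no completeness of H is used. *)

Require Import Defs.
From HB Require Import structures.
From mathcomp Require Import all_boot all_order all_algebra.
From mathcomp Require Import sesquilinear complex.
From mathcomp Require Import all_classical all_reals all_analysis.
From mathcomp Require Import measurable_realfun ess_sup_inf ring.

Import Order.TTheory GRing.Theory Num.Theory.
Local Open Scope ring_scope.

Set Implicit Arguments.
Unset Strict Implicit.
Unset Printing Implicit Defensive.

(** * Bounded multipliers on L2 of the circle *)

Section BoundedMultipliers.
Variable R : realType.
Local Notation C := R[i].
Local Notation circ := (circ R).

(** The uniform norm is defined by a case split on the total mass being positive; [circ] has mass 1,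
    so it is the essential supremum. *)
Lemma Lfun_oo_bounded (v : R -> R) : v \in Lfun circ +oo%E ->
  exists M : R, {ae circ, forall t, `|v t| <= M}.
Proof.
rewrite inE => /andP[_]; rewrite inE /= /finite_norm unlock.
case: ifP => [_ /ess_supr_bounded[M hM]|/negP[]]; first by exists M.
apply: lt_le_trans (@lte01 R) _.
by rewrite -(@probability_setT _ _ _ circ); exact: lexx.
Qed.

Lemma Lfun_mul_oo (u v : R -> R) : v \in Lfun circ +oo%E ->
  u \in Lfun circ 2%:E -> (fun t => v t * u t) \in Lfun circ 2%:E.
Proof.
move=> vL uL; have [M vM] := Lfun_oo_bounded vL.
move: (vL) (uL) => /[!inE] /andP[/[!inE]/= mv _] /andP[/[!inE]/= mu _].
have M0 := normr_ge0 M.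
have := Lfun_scale `|M| (ler1n _ 2) uL.
move=> /(Lfun_integrable (ler1n _ 2)) /integrable_lty iM.
apply/andP; split; rewrite inE /=; first exact: measurable_funM.
rewrite /finite_norm unlock /Lnorm poweR_lty //.
apply: le_lt_trans (iM measurableT).
have mp (w : R -> R) : measurable_fun [set: R] w ->
    measurable_fun [set: R] (fun t => (`|w t| `^ 2)%:E).
  move=> mw; apply/measurable_EFinP.
  apply: (@measurableT_comp _ _ _ _ _ _ (@powR R ^~ 2)) => //.
  exact: measurableT_comp.
apply: ae_ge0_le_integral.
- exact: measurableT.
- by move=> t _; rewrite /= lee_fin powR_ge0.
- by apply: (mp (fun t => v t * u t)); exact: measurable_funM.
- by move=> t _; rewrite lee_fin powR_ge0.
- by apply: mp; exact: measurable_funM.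
apply: (@filterS _ _ (ae_filter_ringOfSetsType circ) _ _ _ vM) => t /= vt _.
rewrite lee_fin ge0_ler_powR ?nnegrE //.
rewrite /= !normrM normr_id mulrC ler_wpM2l //.
exact: le_trans vt (ler_norm _).
Qed.

Lemma Lfun_ooM (u v : R -> R) : v \in Lfun circ +oo%E ->
  u \in Lfun circ +oo%E -> (fun t => v t * u t) \in Lfun circ +oo%E.
Proof.
move=> vL uL; have [M vM] := Lfun_oo_bounded vL.
have [M' uM] := Lfun_oo_bounded uL.
move: (vL) (uL) => /[!inE] /andP[/[!inE]/= mv _] /andP[/[!inE]/= mu _].
apply/andP; split; rewrite inE /=; first exact: measurable_funM.
rewrite /finite_norm unlock; case: ifP => // _.
apply: (@le_lt_trans _ _ (`|M| * `|M'|)%:E); last exact: ltry.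
apply/ess_supP; apply: ae_circ2 vM uM => t /= vt ut.
rewrite lee_fin normrM ler_pM //; exact: le_trans (ler_norm _).
Qed.

Lemma Lcirc_mul_oo p (m f : C -> C) : (p = 2%:E \/ p = +oo%E) ->
  m \in Lcirc +oo%E -> f \in Lcirc p -> (fun z => m z * f z) \in Lcirc p.
Proof.
move=> hp /andP[m1 m2] /andP[f1 f2].
have p1 : (1 <= p)%E.
  by case: hp => ->; [rewrite lee_fin ler1n | exact: leey].
have M u v : u \in Lfun circ +oo%E -> v \in Lfun circ p ->
    (fun t => u t * v t) \in Lfun circ p.
  by case: hp => -> uL vL; [exact: Lfun_mul_oo | exact: Lfun_ooM].
apply/andP; split.
  apply: eq_Lfun (Lfun_lin (-1) p1 (M _ _ m2 f2) (M _ _ m1 f1)) => t /=.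
  by case: (m _) => ? ?; case: (f _) => ? ? /=; rewrite mulN1r addrC.
apply: eq_Lfun (Lfun_lin 1 p1 (M _ _ m1 f2) (M _ _ m2 f1)) => t /=.
by case: (m _) => ? ?; case: (f _) => ? ? /=; rewrite mul1r.
Qed.

Lemma Lcirc_oo2 (m : C -> C) : m \in Lcirc +oo%E -> m \in Lcirc 2%:E.
Proof.
have h : {subset Lfun circ +oo%E <= Lfun circ 2%:E}.
  apply: Lfun_subset => //; first by rewrite lee_fin ler1n.
  - exact: leey.
  - exact: fin_num_measure.
  - exact: leey.
by move=> /andP[m1 m2]; apply/andP; split; apply: h.
Qed.

Lemma Lcirc_cst p (c : C) : (1 <= p)%E -> (fun=> c) \in Lcirc p.
Proof.
move=> p1; have := Lcirc_submod p1 c (Lcirc_exp 0 p1) (Lcirc0 p1).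
by apply: eq_Lcirc => z; rewrite expr0 mulr1 addr0.
Qed.

Lemma Lcirc_sumI p (I : Type) (r : seq I) (P : pred I) (f : I -> C -> C) :
  (1 <= p)%E -> (forall i, P i -> f i \in Lcirc p) ->
  (fun z => \sum_(i <- r | P i) f i z) \in Lcirc p.
Proof.
move=> p1 fL; elim: r => [|i r IH].
  by apply: eq_Lcirc (Lcirc0 p1) => z; rewrite big_nil.
case Pi: (P i); last by apply: eq_Lcirc IH => z; rewrite big_cons Pi.
have := Lcirc_submod p1 1 (fL i Pi) IH.
by apply: eq_Lcirc => z; rewrite big_cons Pi mul1r.
Qed.

Lemma Lcirc_horner (p : {poly C}) : (fun z => p.[z]) \in Lcirc +oo%E.
Proof.
have p1 : (1 <= +oo :> \bar R)%E by exact: leey.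
have := @Lcirc_sumI +oo%E _ (index_enum 'I_(size p)) xpredT
  (fun i z => p`_i * z ^+ i) p1 _.
move=> h; apply: eq_Lcirc (h _) => [z|i _]; first by rewrite horner_coef.
apply: Lcirc_mul_oo; [by right | exact: Lcirc_cst | exact: Lcirc_exp].
Qed.

Lemma norm_cis t : `|cis t : C| = 1.
Proof. by rewrite /cis normc_def /= cos2Dsin2 sqrtr1. Qed.

Lemma conj_cis t : (cis t : C)^* = (cis t)^-1.
Proof.
have h : (cis t : C) * (cis t)^* = 1 by rewrite -normCK norm_cis expr1n.
have c0 : (cis t : C) != 0 by rewrite -normr_eq0 norm_cis oner_eq0.
by apply: (mulfI c0); rewrite h mulfV.
Qed.

End BoundedMultipliers.

(** * Multiplication operators with bounded matrix symbols *)

Section Multiplication.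
Variables (R : realType) (n : nat).
Local Notation C := R[i].
Local Notation circ := (circ R).
Local Notation L2 := (L2 R n).

Lemma L2eqP (F G : L2) : ae_eq_circ (L2fun F) (L2fun G) -> F = G.
Proof. by move/sqfun_classP; rewrite !L2reprK. Qed.

Lemma L2classE (f : C -> 'cV[C]_n) :
  (forall i, (fun z => f z i 0) \in Lcirc 2%:E) ->
  ae_eq_circ (L2fun (L2class f)) f.
Proof.
move=> fL; have fL2 : f \in @L2pred R n by apply/forallP.
have /sqfun_classP : sqfun_class (L2repr (L2class f)) =
    sqfun_class (insubd (0 : sqfun R n) f) by rewrite L2reprK.
by move=> h; apply: ae_circ2 (h) (h) => t e _; rewrite [LHS]e insubdK.
Qed.

Fact opM_key : unit. Proof. exact: tt. Qed.

(** Locked to keep unification from unfolding products into quotient classes. *)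
Definition opM : (C -> 'M[C]_n) -> L2 -> L2 :=
  locked_with opM_key (fun Psi F => L2class (fun z => Psi z *m L2fun F z)).

Lemma opM_unlock Psi F : opM Psi F = L2class (fun z => Psi z *m L2fun F z).
Proof. by rewrite /opM unlock. Qed.

Lemma opM_Lcirc (Psi : C -> 'M[C]_n) F i : L_mx +oo%E Psi ->
  (fun z => (Psi z *m L2fun F z) i 0) \in Lcirc 2%:E.
Proof.
move=> PL.
have := @Lcirc_sum R 2%:E n (fun k z => Psi z i k * L2fun F z k 0) (lee1n 2) _.
move=> h; apply: eq_Lcirc (h _) => [z|k]; first by rewrite mxE.
by apply: Lcirc_mul_oo; [left | exact: PL | exact: L2fun_L2].
Qed.

Lemma opME (Psi : C -> 'M[C]_n) F : L_mx +oo%E Psi ->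
  ae_eq_circ (L2fun (opM Psi F)) (fun z => Psi z *m L2fun F z).
Proof.
by move=> PL; rewrite opM_unlock; apply: L2classE => i; exact: opM_Lcirc.
Qed.

Lemma opM_linear (Psi : C -> 'M[C]_n) : L_mx +oo%E Psi -> linear (opM Psi).
Proof.
move=> PL a F G; apply: L2eqP.
apply: ae_circ_trans (opME _ PL) _.
apply: ae_circ_trans (ae_circ_sym (L2funP _ _ _)).
apply: (@filterS3 _ _ (ae_filter_ringOfSetsType circ)
  _ _ _ _ _ (L2funP a F G) (opME F PL) (opME G PL)) => t e1 e2 e3.
transitivity (Psi (cis t) *m (a *: L2fun F (cis t) + L2fun G (cis t))).
  exact: congr1 e1.
rewrite mulmxDr -scalemxAr; congr (_ + _); last exact: esym e3.
by congr (_ *: _); exact: esym e2.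
Qed.

Lemma L_mxM (P Q : C -> 'M[C]_n) : L_mx +oo%E P -> L_mx +oo%E Q ->
  L_mx +oo%E (fun z => P z *m Q z).
Proof.
move=> PL QL i j.
have := @Lcirc_sum R +oo%E n (fun k z => P z i k * Q z k j) (leey _) _.
move=> h; apply: eq_Lcirc (h _) => [z|k]; first by rewrite mxE.
by apply: Lcirc_mul_oo; [right | exact: PL | exact: QL].
Qed.

Lemma L_mxP (a : C) (P Q : C -> 'M[C]_n) : L_mx +oo%E P -> L_mx +oo%E Q ->
  L_mx +oo%E (fun z => a *: P z + Q z).
Proof.
move=> PL QL i j; have := Lcirc_submod (leey _) a (PL i j) (QL i j).
by apply: eq_Lcirc => z; rewrite !mxE.
Qed.

Lemma L_mx_adj (P : C -> 'M[C]_n) : L_mx +oo%E P ->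
  L_mx +oo%E (fun z => adjmx (P z)).
Proof.
move=> PL i j; apply: eq_Lcirc (Lcirc_conj (leey _) (PL j i)) => z.
by rewrite !mxE.
Qed.

Lemma L_mx_scalar (m : C -> C) : m \in Lcirc +oo%E ->
  L_mx +oo%E (fun z => (m z)%:M : 'M[C]_n).
Proof.
move=> mL i j; case: (eqVneq i j) => [->|ij].
  by apply: eq_Lcirc mL => z; rewrite mxE eqxx.
by apply: eq_Lcirc (Lcirc0 (leey _)) => z; rewrite mxE (negbTE ij).
Qed.

Lemma L_mx_cst (A : 'M[C]_n) : L_mx +oo%E (fun=> A).
Proof. by move=> i j; apply: Lcirc_cst; exact: leey. Qed.

Lemma opM_comp (P Q : C -> 'M[C]_n) F : L_mx +oo%E P -> L_mx +oo%E Q ->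
  opM P (opM Q F) = opM (fun z => P z *m Q z) F.
Proof.
move=> PL QL; apply: L2eqP; apply: ae_circ_trans (opME _ PL) _.
apply: ae_circ_trans (ae_circ_sym (opME _ (L_mxM PL QL))).
apply: ae_circ2 (opME F QL) (opME F QL) => t e _.
by rewrite -mulmxA; exact: congr1 e.
Qed.

Lemma opM_ae (P Q : C -> 'M[C]_n) F : L_mx +oo%E P -> L_mx +oo%E Q ->
  ae_eq_circ P Q -> opM P F = opM Q F.
Proof.
move=> PL QL PQ; apply: L2eqP; apply: ae_circ_trans (opME _ PL) _.
apply: ae_circ_trans (ae_circ_sym (opME _ QL)).
apply: ae_circ2 (PQ) (PQ) => t e _.
exact: (congr1 (mulmx^~ _) e).
Qed.

Lemma opMP (a : C) (P Q : C -> 'M[C]_n) F : L_mx +oo%E P -> L_mx +oo%E Q ->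
  opM (fun z => a *: P z + Q z) F = a *: opM P F + opM Q F.
Proof.
move=> PL QL; apply: L2eqP; apply: ae_circ_trans (opME _ (L_mxP a PL QL)) _.
apply: ae_circ_trans (ae_circ_sym (L2funP _ _ _)).
apply: ae_circ2 (opME F PL) (opME F QL) => t e1 e2.
rewrite mulmxDl -scalemxAl; congr (_ + _); last exact: esym e2.
by congr (_ *: _); exact: esym e1.
Qed.

Lemma opM1 F : opM (fun=> 1%:M) F = F.
Proof.
apply: L2eqP; apply: ae_circ_trans (opME _ (L_mx_cst _)) _.
by apply/aeW => t; rewrite mul1mx.
Qed.

Lemma opM0 F : opM (fun=> 0) F = 0.
Proof.
have := opMP (-1) F (L_mx_cst 0) (L_mx_cst 0).
by rewrite scaler0 addr0 scaleN1r addNr.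
Qed.

Lemma opM_adj (P : C -> 'M[C]_n) F G : L_mx +oo%E P ->
  L2ip (opM P F) G = L2ip F (opM (fun z => adjmx (P z)) G).
Proof.
move=> PL; apply: circ_int_ae; [exact: L2ip_Lcirc..|].
apply: ae_circ2 (opME F PL) (opME G (L_mx_adj PL)) => t e1 e2.
transitivity (\sum_i (P (cis t) *m L2fun F (cis t)) i 0
                * (L2fun G (cis t) i 0)^*).
  apply: eq_bigr => i _; congr (_ * _).
  exact: (congr1 (fun v : 'cV_n => v i 0) e1).
transitivity (\sum_i L2fun F (cis t) i 0
                * ((adjmx (P (cis t)) *m L2fun G (cis t)) i 0)^*); last first.
  apply: eq_bigr => i _; congr (_ * _^*).
  exact: (congr1 (fun v : 'cV_n => v i 0) (esym e2)).
transitivity (\sum_i \sum_k P (cis t) i k * L2fun F (cis t) k 0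
                * (L2fun G (cis t) i 0)^*).
  by apply: eq_bigr => i _; rewrite mxE mulr_suml.
rewrite exchange_big; apply: eq_bigr => k _ /=.
rewrite mxE rmorph_sum mulr_sumr; apply: eq_bigr => i _ /=.
by rewrite /adjmx !mxE rmorphM /= conjCK mulrA [P _ _ _ * _]mulrC.
Qed.

Definition opS (m : C -> C) := opM (fun z => (m z)%:M).

Lemma opS_linear m : m \in Lcirc +oo%E -> linear (opS m).
Proof. by move=> mL; apply: opM_linear; exact: L_mx_scalar. Qed.

Lemma opS_comp (m k : C -> C) F : m \in Lcirc +oo%E -> k \in Lcirc +oo%E ->
  opS m (opS k F) = opS (fun z => m z * k z) F.
Proof.
move=> mL kL; rewrite /opS opM_comp; [|exact: L_mx_scalar..].
by congr opM; apply/funext => z; rewrite -scalar_mxM.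
Qed.

Lemma opSP a (m k : C -> C) F : m \in Lcirc +oo%E -> k \in Lcirc +oo%E ->
  opS (fun z => a * m z + k z) F = a *: opS m F + opS k F.
Proof.
move=> mL kL; rewrite /opS -opMP; [|exact: L_mx_scalar..].
by congr opM; apply/funext => z; rewrite scale_scalar_mx raddfD.
Qed.

Lemma opS_opM m P F : m \in Lcirc +oo%E -> L_mx +oo%E P ->
  opS m (opM P F) = opM P (opS m F).
Proof.
move=> mL PL; have mL' := L_mx_scalar mL.
rewrite /opS (opM_comp F mL' PL) (opM_comp F PL mL').
by congr opM; apply/funext => z; rewrite scalar_mxC.
Qed.

Lemma opS_adj m F G : m \in Lcirc +oo%E ->
  L2ip (opS m F) G = L2ip F (opS (fun z => (m z)^*) G).
Proof.
move=> mL; rewrite /opS (opM_adj _ _ (L_mx_scalar mL)); congr (L2ip F _).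
apply: (congr1 (opM^~ G)); apply/funext => z.
by rewrite /adjmx tr_scalar_mx map_scalar_mx.
Qed.

Lemma opS_ae (m k : C -> C) F : m \in Lcirc +oo%E -> k \in Lcirc +oo%E ->
  ae_eq_circ m k -> opS m F = opS k F.
Proof.
move=> mL kL mk; apply: opM_ae; [exact: L_mx_scalar..|].
apply: ae_circ2 (mk) (mk) => t e _; exact: (congr1 (@scalar_mx _ n) e).
Qed.

Lemma opS_cst (a : C) F : opS (fun=> a) F = a *: F.
Proof.
apply: L2eqP; apply: ae_circ_trans (opME _ (L_mx_cst _)) _.
(* [h0] says that the chosen representative of the class 0 vanishes almost everywhere; [h] relates
   the representatives of [a *: F] and [F] up to that null term. *)
have h := L2funP a F 0; have h0 := L2funP (-1) 0 (0 : L2).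
apply: ae_circ2 h h0 => t; rewrite addr0 => e1.
rewrite scaler0 addr0 scaleN1r addNr => e2.
rewrite mul_scalar_mx [RHS]e1 -[LHS]addr0; congr (_ + _); exact: esym e2.
Qed.

End Multiplication.

(** * Bilateral shifts *)

Section DotGeometry.
Variables (R : realType).
Local Notation C := R[i].
Variables (L : lmodType C) (ip : {dot L for Num.conj}).
Local Notation "'[ u , v ]" := (ip u v) : ring_scope.

Lemma dotC u v : '[u, v] = '[v, u]^*.
Proof. by rewrite hermC expr0 mul1r. Qed.

Lemma dotDl u v w : '[u + v, w] = '[u, w] + '[v, w].
Proof. exact: linearDl. Qed.

Lemma dotDr u v w : '[u, v + w] = '[u, v] + '[u, w].
Proof. exact: linearDr. Qed.

Lemma dotBl u v w : '[u - v, w] = '[u, w] - '[v, w].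
Proof. exact: linearBl. Qed.

Lemma dotBr u v w : '[u, v - w] = '[u, v] - '[u, w].
Proof. exact: linearBr. Qed.

Lemma dotZl a u v : '[a *: u, v] = a * '[u, v].
Proof. exact: linearZl_LR. Qed.

Lemma dotZr a u v : '[u, a *: v] = a^* * '[u, v].
Proof. exact: linearZr_LR. Qed.

Lemma dot0l u : '[0, u] = 0.
Proof. exact: linear0l. Qed.

Lemma dot0r u : '[u, 0] = 0.
Proof. exact: linear0r. Qed.

Lemma bessel (e : nat -> L) (w : L) N :
  (forall i j, '[e i, e j] = (i == j)%:R) ->
  \sum_(i < N) `|'[w, e i]| ^+ 2 <= '[w, w].
Proof.
move=> he.
(* [w'] is [w] minus its projections on the first [N] vectors; its pairings with the later vectors
   are unchanged, which lets the induction continue. *)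
have [w' [hw _]] : exists w',
    '[w', w'] = '[w, w] - \sum_(i < N) `|'[w, e i]| ^+ 2 /\
    forall j, (N <= j)%N -> '[w', e j] = '[w, e j].
  elim: N => [|N [w' [hw he']]].
    by exists w; rewrite big_ord0 subr0.
  exists (w' - '[w, e N] *: e N); split.
    have d : '[w', '[w, e N] *: e N] = `|'[w, e N]| ^+ 2.
      by rewrite dotZr he' // normCK mulrC.
    rewrite dnormB d dnormZ he eqxx mulr1 hw big_ord_recr /=.
    have -> : (`|'[w, e N]| ^+ 2)^* = `|'[w, e N]| ^+ 2.
      by rewrite rmorphXn /= conj_normC.
    by rewrite opprD addrA addrK opprD addrA.
  move=> j Nj; rewrite dotBl dotZl he (ltn_eqF Nj) mulr0 subr0.
  by rewrite he' // ltnW.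
by rewrite -subr_ge0 -hw dnorm_ge0.
Qed.

(** If the first coefficient were nonzero, the first N coefficients would contribute at least N
    times its square to Bessel's sum, which is bounded by the squared norm of [w]. *)
Lemma bessel_growing (e : nat -> L) (w : L) :
  (forall i j, '[e i, e j] = (i == j)%:R) ->
  (forall k, `|'[w, e k]| <= `|'[w, e k.+1]|) -> '[w, e 0%N] = 0.
Proof.
move=> he hw; apply/eqP/negPn/negP => x0.
have mono k : `|'[w, e 0%N]| <= `|'[w, e k]|.
  by elim: k => // k IH; exact: le_trans IH (hw k).
(* Both quantities are real; they are moved to [R], where the Archimedean property is available. *)
pose r := complex.Re (`|'[w, e 0%N]| ^+ 2); pose M := complex.Re '[w, w].
have rE : `|'[w, e 0%N]| ^+ 2 = r%:C%C.
  by apply/esym/RRe_real; rewrite ger0_real // exprn_ge0.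
have ME : '[w, w] = M%:C%C by apply/esym/RRe_real; rewrite ger0_real // dnorm_ge0.
have r0 : 0 < r by rewrite -ltcR -rE exprn_gt0 // normr_gt0.
have b N : N%:R * r <= M.
  rewrite -lecR -ME; apply: le_trans (bessel w N he).
  rewrite rmorphM /= -rE rmorph_nat mulr_natl -[N in _ *+ N]card_ord -sumr_const.
  by apply: ler_sum => i _; rewrite lerXn2r ?nnegrE.
have := b (Num.bound (M / r)); rewrite -ler_pdivlMr // leNgt.
rewrite archi_boundP // divr_ge0 ?(ltW r0) // -lecR -ME; exact: dnorm_ge0.
Qed.

End DotGeometry.

(* Models multiplication by z on the square-integrable functions on the
   circle, with [cst_of] the inclusion of the constants and [resolvent a] the
   multiplication by 1 / (z - a). *)
Record bilateral_shift (R : realType) (n : nat) (L : lmodType R[i])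
    (ip : {dot L for Num.conj}) := BilateralShift {
  shift : {linear L -> L};
  unshift : L -> L;
  cst_of : {linear 'cV[R[i]]_n -> L};
  resolvent : R[i] -> L -> L;
  shiftK : cancel shift unshift;
  unshiftK : cancel unshift shift;
  shift_adj : forall F G, ip (shift F) G = ip F (unshift G);
  cst_of_wandering : forall k c d,
    ip (iter k.+1 shift (cst_of c)) (cst_of d) = 0;
  cst_of_dot : forall c d,
    ip (cst_of c) (cst_of d) = \sum_i c i 0 * (d i 0)^*;
  resolventK : forall a F, `|a| != 1 ->
    shift (resolvent a F) - a *: resolvent a F = F }.

(** * The Hardy space of an abstract bilateral shift *)

Section AbstractHardy.
Variables (R : realType) (n : nat).
Local Notation C := R[i].
Variables (L : lmodType C) (ip : {dot L for Num.conj}).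
Variable S : bilateral_shift n ip.
Local Notation "'[ u , v ]" := (ip u v) : ring_scope.
Local Notation Z := (shift S).
Local Notation Zi := (unshift S).
Local Notation kap := (cst_of S).
Local Notation res := (resolvent S).

Fact shift_sub_key : unit. Proof. exact: tt. Qed.

Definition shift_sub : C -> L -> L :=
  locked_with shift_sub_key (fun a F => Z F - a *: F).
Local Notation D := shift_sub.

Lemma shift_subE a F : D a F = Z F - a *: F.
Proof. by rewrite /shift_sub unlock. Qed.

Fact shift_sub_linear a : linear (D a).
Proof.
move=> c F G; rewrite !shift_subE linearP scalerDr scalerBr opprD !scalerA mulrC.
by rewrite addrACA.
Qed.
HB.instance Definition _ a :=
  GRing.isLinear.Build C L L *:%R (D a) (shift_sub_linear a).

Lemma shift_subD a F G : D a (F + G) = D a F + D a G.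
Proof. exact: linearD. Qed.

Lemma shift_subB a F G : D a (F - G) = D a F - D a G.
Proof. exact: linearB. Qed.

Lemma shift_subZ a c F : D a (c *: F) = c *: D a F.
Proof. exact: linearZ. Qed.

Definition shift_prod (s : seq C) (F : L) : L := foldr D F s.
Local Notation W := shift_prod.

Fact shift_prod_linear s : linear (W s).
Proof. by move=> c F G; elim: s => //= a s ->; rewrite linearP. Qed.
HB.instance Definition _ s :=
  GRing.isLinear.Build C L L *:%R (W s) (shift_prod_linear s).

(** The Hardy space: pairing the shift of order k+1 with constants reads off the Fourier coefficient
    of index -(k+1). *)
Definition analytic (F : L) : Prop :=
  forall k c, '[iter k.+1 Z F, kap c] = 0.
Local Notation H := analytic.

Definition coanalytic (r : L) : Prop := forall K, H K -> '[r, K] = 0.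

Lemma unshift_adj F G : '[Zi F, G] = '[F, Z G].
Proof. by rewrite dotC -shift_adj -dotC. Qed.

Lemma iter_shift_adj k F G : '[iter k Z F, G] = '[F, iter k Zi G].
Proof. by elim: k G => // k IH G; rewrite iterS shift_adj IH -iterSr. Qed.

Lemma iter_unshift_adj k F G : '[iter k Zi F, G] = '[F, iter k Z G].
Proof. by rewrite dotC -iter_shift_adj -dotC. Qed.

Lemma iter_shift_linear k a F G :
  iter k Z (a *: F + G) = a *: iter k Z F + iter k Z G.
Proof. by elim: k => //= k ->; rewrite linearP. Qed.

Lemma iter_shiftK k : cancel (iter k Z) (iter k Zi).
Proof.
elim: k => // k IH F; by rewrite iterSr iterS shiftK IH.
Qed.

Lemma iter_unshiftK k : cancel (iter k Zi) (iter k Z).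
Proof.
elim: k => // k IH F; by rewrite iterSr iterS unshiftK IH.
Qed.

Lemma cst_of_wandering_unshift k c d : '[iter k.+1 Zi (kap c), kap d] = 0.
Proof. by rewrite iter_unshift_adj dotC cst_of_wandering conjC0. Qed.

(** The vectors [iter k V (kap c)] are orthogonal of equal norm, and the pairings of [w] with them
    are those of [iter k U w] with [kap c]. After normalization [bessel_growing] applies. This is
    the only analytic input: coefficients that do not decrease in modulus vanish. *)
Lemma coef_growing (U V : L -> L) (w : L) c :
  (forall F G, '[U F, G] = '[F, V G]) ->
  (forall F G, '[V F, V G] = '[F, G]) ->
  (forall k, '[iter k.+1 V (kap c), kap c] = 0) ->
  (forall k, `|'[iter k U w, kap c]| <= `|'[iter k.+1 U w, kap c]|) ->
  '[w, kap c] = 0.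
Proof.
move=> adj iso wand grow; pose q := '[kap c, kap c].
have iadj k F G : '[iter k U F, G] = '[F, iter k V G].
  by elim: k G => // k IH G; rewrite iterS adj IH -iterSr.
have [q0|q0] := eqVneq q 0.
  by move/eqP: q0; rewrite dnorm_eq0 => /eqP ->; rewrite dot0r.
have orth i j : '[iter i V (kap c), iter j V (kap c)] = (i == j)%:R * q.
  elim: i j => [|i IH] [|j].
  - by rewrite mul1r.
  - by rewrite dotC wand conjC0 mul0r.
  - by rewrite wand mul0r.
  - by rewrite !iterS iso IH eqSS.
have q1 : sqrtC q != 0 by rewrite sqrtC_eq0.
have qE : q = sqrtC q * sqrtC q by rewrite -expr2 sqrtCK.
have sr : ((sqrtC q)^-1)^* = (sqrtC q)^-1.
  by rewrite conj_Creal // rpredV ger0_real // sqrtC_ge0 dnorm_ge0.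
pose e k := (sqrtC q)^-1 *: iter k V (kap c).
have we k : '[w, e k] = (sqrtC q)^-1 * '[iter k U w, kap c].
  by rewrite dotZr iadj sr.
have := @bessel_growing _ _ ip e w.
rewrite we => h; have : (sqrtC q)^-1 * '[w, kap c] = 0.
  apply: h => [i j|k].
    rewrite dotZl dotZr orth sr {3}qE.
    by rewrite [_%:R * _]mulrC !mulrA mulfVK // mulVf // mul1r.
  by rewrite !we !normrM ler_wpM2l.
by move/eqP; rewrite mulf_eq0 invr_eq0 (negbTE q1) /= => /eqP.
Qed.

Lemma shift_isometry F G : '[Z F, Z G] = '[F, G].
Proof. by rewrite shift_adj shiftK. Qed.

Lemma unshift_isometry F G : '[Zi F, Zi G] = '[F, G].
Proof. by rewrite unshift_adj unshiftK. Qed.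

Lemma coef_growing_shift (w : L) c :
  (forall k, `|'[iter k Z w, kap c]| <= `|'[iter k.+1 Z w, kap c]|) ->
  '[w, kap c] = 0.
Proof.
apply: (coef_growing (V := Zi)); first exact: shift_adj.
  exact: unshift_isometry.
by move=> k; exact: cst_of_wandering_unshift.
Qed.

Lemma coef_growing_unshift (w : L) c :
  (forall k, `|'[iter k Zi w, kap c]| <= `|'[iter k.+1 Zi w, kap c]|) ->
  '[w, kap c] = 0.
Proof.
apply: (coef_growing (V := Z)); first exact: unshift_adj.
  exact: shift_isometry.
by move=> k; exact: cst_of_wandering.
Qed.

Lemma analyticP a F G : H F -> H G -> H (a *: F + G).
Proof.
by move=> hF hG k c; rewrite iter_shift_linear dotDl dotZl hF hG mulr0 addr0.
Qed.

Lemma analytic0 : H 0.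
Proof.
by move=> k c; rewrite iter_shift_adj dot0l.
Qed.

Lemma analyticZ a F : H F -> H (a *: F).
Proof. by move=> hF; rewrite -[_ *: _]addr0; apply: analyticP hF analytic0. Qed.

Lemma analyticD F G : H F -> H G -> H (F + G).
Proof. by move=> hF; rewrite -[F]scale1r; exact: analyticP. Qed.

Lemma analyticB F G : H F -> H G -> H (F - G).
Proof. by move=> hF hG; rewrite addrC -scaleN1r; exact: analyticP. Qed.

Lemma analytic_cst c : H (kap c).
Proof. by move=> k d; exact: cst_of_wandering. Qed.

Lemma analytic_shift F : H F -> H (Z F).
Proof. by move=> hF k c; rewrite -iterSr. Qed.

Lemma analytic_shift_sub a F : H F -> H (D a F).
Proof.
move=> hF; rewrite shift_subE; apply: analyticB; first exact: analytic_shift.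
exact: analyticZ.
Qed.

Lemma analytic_shift_prod s F : H F -> H (W s F).
Proof. by move=> hF; elim: s => //= a s IH; exact: analytic_shift_sub. Qed.

Lemma shiftE a F : Z F = D a F + a *: F.
Proof. by rewrite shift_subE subrK. Qed.

Lemma shift_sub_shift a F : D a (Z F) = Z (D a F).
Proof. by rewrite !shift_subE linearB [Z (a *: _)]linearZ. Qed.

Lemma shift_sub_comm (M : {linear L -> L}) :
  (forall F, M (Z F) = Z (M F)) -> forall a F, M (D a F) = D a (M F).
Proof. by move=> MZ a F; rewrite !shift_subE linearB linearZ MZ. Qed.

Lemma shift_prod_comm (M : {linear L -> L}) :
  (forall F, M (Z F) = Z (M F)) -> forall s F, M (W s F) = W s (M F).
Proof.
by move=> MZ s F; elim: s => //= a s IH; rewrite shift_sub_comm // IH.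
Qed.

Lemma shift_prod_shift s F : W s (Z F) = Z (W s F).
Proof. by rewrite (shift_prod_comm (M := Z)). Qed.

Lemma shift_prodC s s' F : W s (W s' F) = W s' (W s F).
Proof. by apply: shift_prod_comm => G; exact: shift_prod_shift. Qed.

Lemma shift_prod_cat s s' F : W (s ++ s') F = W s (W s' F).
Proof. by rewrite /W foldr_cat. Qed.

Lemma shift_sub_resolvent a F : `|a| != 1 -> D a (res a F) = F.
Proof. by rewrite shift_subE; exact: resolventK. Qed.

(** A nonzero eigenvector of an isometry has a unimodular eigenvalue. *)
Lemma shift_sub_inj a F : `|a| != 1 -> D a F = 0 -> F = 0.
Proof.
rewrite shift_subE => a1 /subr0_eq e; apply/eqP; rewrite -(dnorm_eq0 ip).
have : '[Z F, Z F] = '[F, F] by exact: shift_isometry.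
rewrite e dnormZ -[X in _ = X]mul1r => /eqP; rewrite -subr_eq0 -mulrBl mulf_eq0.
case/orP => //; rewrite subr_eq0 sqrp_eq1 ?normr_ge0 // => a1'.
by rewrite a1' in a1.
Qed.

(** Among the coefficients of [G] of negative index, each is [b] times the previous one as the index
    decreases; since |b| > 1 they grow in modulus, hence vanish. *)
Lemma analytic_out b G : 1 < `|b| -> H (D b G) -> H G.
Proof.
move=> b1 hG k c; apply: (coef_growing_shift (w := iter k.+1 Z G)) => j.
rewrite -!iterD.
have -> : (j.+1 + k.+1 = (j + k.+1).+1)%N by [].
have -> : iter (j + k.+1).+1 Z G =
    iter (j + k.+1) Z (D b G) + b *: iter (j + k.+1) Z G.
  rewrite iterSr (shiftE b) addrC iter_shift_linear addrC //.
rewrite addnS dotDl dotZl hG add0r normrM.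
by rewrite ler_peMl // ltW.
Qed.

Lemma analytic_resolvent b F : 1 < `|b| -> H F -> H (res b F).
Proof.
move=> b1 hF; apply: (analytic_out b1).
by rewrite shift_sub_resolvent // gt_eqF.
Qed.

Lemma lt1_neq1 (a : C) : `|a| < 1 -> `|a| != 1.
Proof. by move=> a1; rewrite lt_eqF. Qed.

(** For |a| < 1 the function c/(z - a) expands in negative powers of z, starting with c/z. *)
Lemma coef_resolvent_cst a c d : `|a| < 1 ->
  '[Z (res a (kap c)), kap d] = '[kap c, kap d].
Proof.
move=> a1; set u := res a (kap c).
have Zu : Z u = kap c + a *: u.
  by rewrite (shiftE a) shift_sub_resolvent // lt1_neq1.
rewrite Zu dotDl dotZl -[RHS]addr0; congr (_ + _).
have [->|a0] := eqVneq a 0; first by rewrite mul0r.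
apply/eqP; rewrite mulf_eq0 (negbTE a0) /=; apply/eqP.
apply: coef_growing_unshift => k.
(* The coefficient of [u] of index k is [a] times that of index k+1, so the moduli grow with k and
   the coefficient of index 0 is zero. *)
have e : iter k Zi u = a *: iter k.+1 Zi u + iter k.+1 Zi (kap c).
  apply: (can_inj (iter_shiftK k.+1)).
  rewrite iter_shift_linear !iter_unshiftK iterS iter_unshiftK.
  by rewrite Zu addrC.
rewrite e dotDl dotZl cst_of_wandering_unshift addr0 normrM.
by rewrite ler_piMl // ltW.
Qed.

Lemma cst_of_dot_inj (x : L) (c : 'cV[C]_n) :
  (forall i, '[x, kap (delta_mx i 0)] = c i 0) ->
  forall d, '[x, kap d] = '[kap c, kap d].
Proof.
move=> h d; rewrite cst_of_dot.
have dE : d = \sum_i d i 0 *: delta_mx i 0.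
  by rewrite [LHS]matrix_sum_delta; apply: eq_bigr => i _; rewrite big_ord1.
rewrite {1}dE linear_sum linear_sumr; apply: eq_bigr => i _ /=.
by rewrite [kap _]linearZ dotZr h mulrC.
Qed.

(* [c] is the value at [a] of the holomorphic extension of [F]. *)
Lemma analytic_div a F : `|a| < 1 -> H F ->
  exists c G, H G /\ F = kap c + D a G.
Proof.
(* Cauchy's formula: the value at [a] is the coefficient of index -1 of F/(z - a). *)
move=> a1 hF; pose c := \col_i '[Z (res a F), kap (delta_mx i 0)].
have hc : forall d, '[Z (res a F), kap d] = '[kap c, kap d].
  by apply: cst_of_dot_inj => i; rewrite mxE.
exists c, (res a F - res a (kap c)).
have DG : D a (res a F - res a (kap c)) = F - kap c.
  by rewrite shift_subB !shift_sub_resolvent ?lt1_neq1.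
split; last by rewrite DG addrC subrK.
(* The choice of [c] cancels the coefficient of index -1; each further one is [a] times its
   predecessor, because [D a] of the quotient is [F - kap c], which is analytic. *)
elim=> [|k IH] d.
  by rewrite /= [Z _]linearB dotBl hc coef_resolvent_cst // subrr.
rewrite iterSr (shiftE a) DG addrC iter_shift_linear dotDl dotZl IH mulr0.
by rewrite add0r; apply: analyticB hF (analytic_cst _) _ _.
Qed.

(** The converse of the choice made in [analytic_div]: any decomposition has its constant given by
    Cauchy's formula. It later identifies the constant with [hardy_eval]. *)
Lemma analytic_valE a F c G d : `|a| < 1 -> H G -> F = kap c + D a G ->
  '[Z (res a F), kap d] = '[kap c, kap d].
Proof.
move=> a1 hG ->; have -> : res a (kap c + D a G) = res a (kap c) + G.
  apply/subr0_eq/(@shift_sub_inj a); first exact: lt1_neq1.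
  by rewrite shift_subB shift_subD !shift_sub_resolvent ?lt1_neq1 // subrr.
by rewrite [Z _]linearD dotDl coef_resolvent_cst // (hG 0%N) addr0.
Qed.

Lemma cst_of_dot_delta (c : 'cV[C]_n) i : '[kap c, kap (delta_mx i 0)] = c i 0.
Proof.
rewrite cst_of_dot (bigD1 i) //= !mxE !eqxx conjC1 mulr1 big1 ?addr0 // => j ji.
by rewrite !mxE (negbTE ji) conjC0 mulr0.
Qed.

Lemma cst_of_inj (c d : 'cV[C]_n) :
  (forall e, '[kap c, kap e] = '[kap d, kap e]) -> c = d.
Proof. by move=> h; apply/colP => i; rewrite -!cst_of_dot_delta h. Qed.

(** The root of 1 - conj(a) z lies outside the closed disc, so division by it preserves
    analyticity. *)
Lemma inv_one_sub_shift a F : `|a| < 1 -> H F ->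
  exists X, H X /\ F = X - a^* *: Z X.
Proof.
move=> a1 hF; have [->|a0] := eqVneq a 0.
  by exists F; rewrite conjC0 scale0r subr0.
have a0' : a^* != 0 by rewrite fmorph_eq0.
have b1 : 1 < `|(a^*)^-1|.
  by rewrite normfV norm_conjC invf_gt1 // normr_gt0.
exists (- (a^*)^-1 *: res (a^*)^-1 F); split.
  by apply: analyticZ; exact: analytic_resolvent.
rewrite [Z (_ *: _)]linearZ /= scalerA mulrN mulfV // scaleN1r opprK scaleNr.
by rewrite addrC; apply/esym/resolventK; rewrite gt_eqF.
Qed.

(** Here K' = z K / (1 - conj(a) z): the adjoint of the resolvent at [a] sends analytic vectors to
    analytic vectors vanishing at the origin. *)
Lemma resolvent_adj a K : `|a| < 1 -> H K ->
  exists K', [/\ H K', Zi K' - a^* *: K' = K & forall c, '[K', kap c] = 0].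
Proof.
move=> a1 hK; have [K' [hK' e]] := inv_one_sub_shift a1 (analytic_shift hK).
exists K'; split => // [|c].
  apply: (can_inj (shiftK S)); rewrite linearB linearZ unshiftK /=.
  exact: esym e.
have -> : K' = Z K + a^* *: Z K' by rewrite e subrK.
by rewrite dotDl dotZl (hK 0%N) (hK' 0%N) mulr0 addr0.
Qed.

(** By [resolvent_adj] it suffices that [r] be orthogonal to the analytic vectors vanishing at 0.
    This covers both coanalytic vectors and constants. *)
Lemma resolvent_coanalytic a r : `|a| < 1 ->
  (forall K, H K -> (forall c, '[K, kap c] = 0) -> '[r, K] = 0) ->
  coanalytic (res a r).
Proof.
move=> a1 hr K hK; have [K' [hK' <- K'0]] := resolvent_adj a1 hK.
rewrite dotBr dotZr conjCK -shift_adj -dotZl -dotBl.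
by rewrite resolventK ?lt1_neq1 //; exact: hr.
Qed.

(** Partial fractions: if (z - a) F = h + r and h = c + (z - a) G, then F = G + (c + r)/(z - a),
    whose last term is coanalytic. The poles are removed one at a time. *)
Lemma projection_exists s F : (forall a, a \in s -> `|a| < 1) ->
  H (W s F) -> exists h r, [/\ H h, coanalytic r & F = h + r].
Proof.
elim: s F => [|a s IH] F s1 hF.
  by exists F, 0; split; rewrite ?addr0 // => K _; rewrite dot0l.
have a1 : `|a| < 1 by rewrite s1 // mem_head.
have WD := shift_prod_comm (M := D a) (shift_sub_shift a) s F.
have s1' b : b \in s -> `|b| < 1 by move=> bs; rewrite s1 // in_cons bs orbT.
have hDF : H (W s (D a F)) by rewrite -WD.
have [h [r [hh hr e]]] := IH (D a F) s1' hDF.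
have [c [G [hG hE]]] := analytic_div a1 hh.
exists G, (res a (kap c) + res a r); split => //.
  move=> K hK; rewrite dotDl !resolvent_coanalytic ?addr0 // => K' hK' K0.
    exact: hr.
  by rewrite dotC K0 conjC0.
apply/subr0_eq/(@shift_sub_inj a); first exact: lt1_neq1.
rewrite shift_subB !shift_subD !shift_sub_resolvent ?lt1_neq1 //= e hE.
by rewrite [X in _ - X]addrCA [X in _ - X]addrA subrr.
Qed.

End AbstractHardy.

(** * Subspaces invariant under a compressed multiplier *)

Section InvariantSubspace.
Variables (R : realType) (n : nat).
Local Notation C := R[i].
Variables (L : lmodType C) (ip : {dot L for Num.conj}).
Variable S : bilateral_shift n ip.
Local Notation Z := (shift S).
Local Notation kap := (cst_of S).
Local Notation res := (resolvent S).
Local Notation D := (shift_sub S).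
Local Notation W := (shift_prod S).
Local Notation H := (analytic S).

Lemma shift_prodD s F G : W s (F + G) = W s F + W s G.
Proof. exact: linearD. Qed.

Lemma shift_sub_prod a s F : D a (W s F) = W s (D a F).
Proof.
by rewrite (shift_prod_comm (M := D a)) // => G; exact: shift_sub_shift.
Qed.

Lemma shift_subC a b F : D a (D b F) = D b (D a F).
Proof. exact: shift_sub_prod a [:: b] F. Qed.

Lemma shift_prod_rem a s F : a \in s -> W s F = D a (W (rem a s) F).
Proof.
elim: s => //= b s IH; rewrite in_cons; have [->|ba] //= := eqVneq b a.
by move=> /IH ->; rewrite (shift_subC a b).
Qed.

Lemma shift_prod_filter (p : pred C) s F :
  W s F = W [seq a <- s | p a] (W [seq a <- s | ~~ p a] F).
Proof.
elim: s => //= a s ->; case: (p a) => //=.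
by rewrite shift_sub_prod.
Qed.

Lemma iter_shift_prod_analytic j s F : H F -> H (iter j (W s) F).
Proof. by move=> hF; elim: j => //= j; exact: analytic_shift_prod. Qed.

Lemma iter_shift_prod_comm (M : {linear L -> L}) :
  (forall F, M (Z F) = Z (M F)) ->
  forall j s F, M (iter j (W s) F) = iter j (W s) (M F).
Proof.
by move=> MZ j s F; elim: j => //= j IH; rewrite shift_prod_comm // IH.
Qed.

Lemma multiplier_analytic (M : {linear L -> L}) s :
  (forall F, M (Z F) = Z (M F)) -> (forall a, a \in s -> `|a| < 1) ->
  (forall F, H F -> H (W s (M F))) -> (forall c, H (M (kap c))) ->
  forall F, H F -> H (M F).
Proof.
move=> MZ; elim: s => [_ hM _|a s IH s1 hM hc]; first exact: hM.
have a1 : `|a| < 1 by rewrite s1 // mem_head.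
apply: IH => // [b bs|F hF]; first by rewrite s1 // in_cons bs orbT.
have [c [G [hG ->]]] := analytic_div a1 hF.
rewrite linearD shift_prodD; apply: analyticD.
  by apply: analytic_shift_prod; exact: hc.
by rewrite shift_sub_comm // -shift_sub_prod; exact: hM.
Qed.

Lemma shift_prod_val a s c : exists G, H G /\
  W s (kap c) = kap ((\prod_(b <- s) (a - b)) *: c) + D a G.
Proof.
elim: s => [|b s [G [hG e]]].
  exists 0; split; first exact: analytic0.
  by rewrite big_nil scale1r [D a 0]linear0 addr0.
set c' := _ *: c in e.
exists (kap c' + D b G); split.
  by apply: analyticD; [exact: analytic_cst | exact: analytic_shift_sub].
rewrite /= e shift_subD [D a (_ + D b G)]shift_subD big_cons -scalerA -/c'.
rewrite addrA (shift_subC b a).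
congr (_ + _); rewrite !shift_subE.
have -> : kap ((a - b) *: c') = (a - b) *: kap c' by exact: linearZ.
by rewrite scalerBl [RHS]addrC addrA subrK.
Qed.

(** A Bezout identity. To add a zero [a] to [s], the value of the cofactor [h] at [a] is matched by
    a multiple of [W s'], whose scalar value [v] at [a] is nonzero. *)
Lemma shift_prod_comaximal s s' : (forall a, a \in s -> `|a| < 1) ->
  (forall a, a \in s -> a \notin s') ->
  forall F, H F -> exists g h, [/\ H g, H h & F = W s' g + W s h].
Proof.
elim: s => [_ _ F hF|a s IH s1 dis F hF].
  exists 0, F; split => //; first exact: analytic0.
  by rewrite [W s' 0]linear0 add0r.
have sub b : b \in s -> b \in a :: s by move=> bs; rewrite in_cons bs orbT.
have [|b bs|g [h [hg hh ->]]] := IH _ _ F hF.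
- by move=> b /sub /s1.
- by move/sub: bs => /dis.
have a1 : `|a| < 1 by rewrite s1 // mem_head.
have [c [G [hG ->]]] := analytic_div a1 hh.
set v := \prod_(b <- s') (a - b).
have v0 : v != 0.
  rewrite prodf_seq_neq0; apply/allP => b bs' /=; rewrite subr_eq0.
  by apply: contraL bs' => /eqP <-; rewrite dis // mem_head.
have [G' [hG' e]] := shift_prod_val a s' (v^-1 *: c).
rewrite -/v scalerA mulfV // scale1r in e.
exists (g + W s (kap (v^-1 *: c))), (G - G'); split.
- apply: analyticD => //; apply: analytic_shift_prod; exact: analytic_cst.
- exact: analyticB.
have -> : kap c + D a G = W s' (kap (v^-1 *: c)) + D a (G - G').
  by rewrite e shift_subB [D a G - _]addrC addrA addrK.
rewrite shift_prodD [W s' (g + _)]shift_prodD addrA (shift_prodC S s s') /=.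
by rewrite shift_sub_prod.
Qed.

(** Each factor of [d], repeated or not, is taken from its own copy of [W s]. *)
Lemma shift_prod_absorb d s F : (forall a, a \in d -> a \in s) -> H F ->
  exists G, H G /\ iter (size d) (W s) F = W d G.
Proof.
move=> + hF; elim: d => [_|a d IH ds]; first by exists F.
have [|G [hG e]] := IH; first by move=> b bd; rewrite ds // in_cons bd orbT.
exists (W (rem a s) G); split; first exact: analytic_shift_prod.
by rewrite /= e (shift_prod_rem _ (ds a (mem_head _ _))) [W _ (W d G)]shift_prodC.
Qed.

Variables (M M' : {linear L -> L}) (E : L -> Prop) (s s' : seq C) (a0 : C).
Hypothesis MZ : forall F, M (Z F) = Z (M F).
Hypothesis M'Z : forall F, M' (Z F) = Z (M' F).
Hypothesis s_disc : forall a, a \in s -> `|a| < 1.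
Hypothesis s'_disc : forall a, a \in s' -> `|a| < 1.
Hypothesis a0s : a0 \in s.
Hypothesis E_analytic : forall F, E F -> H F.
Hypothesis E_linear : forall a F G, E F -> E G -> E (a *: F + G).
Hypothesis E_contains : forall F, H F -> H (M' F) -> E F.
(** On multiples of [W s] the image under [M] is analytic, so equality of the norms of the
    compressions leaves no coanalytic part for [M']. *)
Hypothesis E_cap : forall F, H F -> E (W s F) -> H (M' (W s F)).
Hypothesis E_invariant : forall F h r,
  E F -> H h -> coanalytic S r -> M F = h + r -> E h.
Hypothesis M'_analytic : forall F, H F -> H (W s' (M' F)).
Hypothesis M_analytic : forall F, H F -> H (W s (M F)).
Hypothesis M_val : forall a c, a \in s ->
  exists c' G, H G /\ W s (M (kap c')) = kap c + D a G.

Lemma coanalytic0 : coanalytic S 0.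
Proof. by move=> K _; rewrite dot0l. Qed.

Let E_add F G : E F -> E G -> E (F + G).
Proof. by move=> eF eG; rewrite -[F]scale1r; exact: E_linear. Qed.

Let E_sub F G : E F -> E G -> E (F - G).
Proof. by move=> eF eG; rewrite addrC -scaleN1r; exact: E_linear. Qed.

(** For [l = s] this is H = (t Phi) H + t H. For each new zero the value of the cofactor is matched
    by a value provided by [M_val]. *)
Lemma multiplier_comaximal l : (forall a, a \in l -> a \in s) ->
  forall F, H F -> exists g h, [/\ H g, H h & F = W s (M g) + W l h].
Proof.
elim: l => [_ F hF|a l IH ls F hF].
  exists 0, F; split => //; first exact: analytic0.
  by rewrite [M 0]linear0 [W s 0]linear0 add0r.
have [|g [h [hg hh ->]]] := IH _ F hF.
  by move=> b bl; rewrite ls // in_cons bl orbT.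
have as_ : a \in s by rewrite ls // mem_head.
have [c [G [hG ->]]] := analytic_div (s_disc as_) hh.
have [c' [G' [hG' e]]] := M_val c as_.
exists (g + W l (kap c')), (G - G'); split.
- apply: analyticD => //; apply: analytic_shift_prod; exact: analytic_cst.
- exact: analyticB.
have -> : kap c + D a G = W s (M (kap c')) + D a (G - G').
  by rewrite e shift_subB [D a G - _]addrC addrA addrK.
rewrite shift_prodD [M (_ + _)]linearD /= [W s (_ + _)]shift_prodD addrA.
by rewrite (shift_prodC S l) (shift_prod_comm MZ l) /= shift_sub_prod.
Qed.

(** The factorization d = d1 d2: the zeros of the clearing polynomial of [M'] shared with [s], and
    the others. *)
Let d1 := [seq a <- s' | a \in s].
Let d2 := [seq a <- s' | a \notin s].

Let E_dilate j : (forall F, H F -> E (W d2 (iter j (W s) F))) ->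
  forall F, H F -> E (W d2 F).
Proof.
elim: j => // j IH hE; apply: IH => F hF.
have [|g [h [hg hh ->]]] := @multiplier_comaximal s _ F hF; first by [].
have lin X Y : iter j (W s) (X + Y) = iter j (W s) X + iter j (W s) Y.
  by elim: j {hE} => //= j ->; rewrite shift_prodD.
rewrite lin shift_prodD; apply: E_add; last by rewrite -iterSr; exact: hE.
(* The image of d2 t^(j+1) g under [M] is d2 t^j (t Phi g), already analytic; the compression
   therefore produces it with coanalytic remainder 0. *)
apply: (@E_invariant (W d2 (iter j.+1 (W s) g)) _ 0).
- exact: hE.
- apply: analytic_shift_prod; apply: iter_shift_prod_analytic.
  exact: M_analytic.
- exact: coanalytic0.
by rewrite addr0 (shift_prod_comm MZ) (iter_shift_prod_comm MZ) iterSr.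
Qed.

Let E_d2 F : H F -> E (W d2 F).
Proof.
apply: (@E_dilate (size d1)) => {}F hF.
(* The power [size d1] of t absorbs d1, so together with d2 it is a multiple of the full polynomial
   d, which clears [M']. *)
have [|G [hG ->]] := @shift_prod_absorb d1 s F _ hF.
  by move=> a; rewrite mem_filter => /andP[].
rewrite shift_prodC -(shift_prod_filter [in s]).
apply: E_contains; first exact: analytic_shift_prod.
by rewrite (shift_prod_comm M'Z); exact: M'_analytic.
Qed.

Let E_shift F : E F -> E (Z F).
Proof.
move=> eF; have hF := E_analytic eF.
have [|g [h [hg hh e]]] := @shift_prod_comaximal s d2 s_disc _ F hF.
  by move=> a as_; rewrite mem_filter /= as_.
have eh : E (W s h).
  have -> : W s h = F - W d2 g by rewrite e addrC addKr.
  by apply: E_sub => //; exact: E_d2.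
rewrite e linearD; apply: E_add.
  by rewrite -shift_prod_shift; apply: E_d2; exact: analytic_shift.
apply: E_contains.
  by apply: analytic_shift; exact: analytic_shift_prod.
by rewrite M'Z; apply: analytic_shift; exact: E_cap.
Qed.

Let E_shift_sub a F : E F -> E (D a F).
Proof.
move=> eF; rewrite shift_subE addrC -scaleNr.
by apply: E_linear => //; exact: E_shift.
Qed.

Let E_shift_prod l F : E F -> E (W l F).
Proof. by move=> eF; elim: l => //= a l; exact: E_shift_sub. Qed.

Let E_cst c : E (kap c).
Proof.
(* [v] is the value of d2 at [a0], nonzero as d2 is prime to t. Scaling by its inverse makes q = d2
   t Phi c' take the value [c] at [a0]. *)
set v := \prod_(b <- d2) (a0 - b).
have v0 : v != 0.
  rewrite prodf_seq_neq0; apply/allP => b; rewrite mem_filter /= subr_eq0.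
  by case/andP=> bs _; apply: contra bs => /eqP <-.
have a1 := s_disc a0s.
have [c' [G [hG e]]] := M_val (v^-1 *: c) a0s.
have [G' [hG' e']] := shift_prod_val a0 d2 (v^-1 *: c).
rewrite -/v scalerA mulfV // scale1r in e'.
pose X := W d2 (W (rem a0 s) (kap c')).
pose G2 := G' + W d2 G.
have hG2 : H G2 by apply: analyticD => //; exact: analytic_shift_prod.
have DMX : D a0 (M X) = kap c + D a0 G2.
  rewrite /X (shift_prod_comm MZ) (shift_prod_comm MZ) shift_sub_prod.
  rewrite -shift_prod_rem // e shift_prodD e' shift_subD addrA.
  by rewrite shift_sub_prod.
(* [G2] is (q - q(a0))/(z - a0), and the remaining term c/(z - a0) is coanalytic; the compression of
   [M X] is thus [G2]. *)
have MX : M X = G2 + res a0 (kap c).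
  apply/subr0_eq/(@shift_sub_inj _ _ _ _ S a0); first exact: lt1_neq1.
  rewrite shift_subB shift_subD shift_sub_resolvent ?lt1_neq1 //.
  by rewrite DMX [kap c + _]addrC subrr.
have EX : E X.
  by apply: E_d2; apply: analytic_shift_prod; exact: analytic_cst.
have EG2 : E G2.
  apply: (E_invariant EX hG2 _ MX).
  by apply: resolvent_coanalytic => // K hK K0; rewrite dotC K0 conjC0.
have Eq : E (kap c + D a0 G2).
  have -> : kap c + D a0 G2 = W d2 (kap (v^-1 *: c) + D a0 G).
    by rewrite shift_prodD e' shift_subD addrA shift_sub_prod.
  apply: E_d2; apply: analyticD; first exact: analytic_cst.
  exact: analytic_shift_sub.
by rewrite -[kap c](addrK (D a0 G2)); apply: E_sub => //; exact: E_shift_sub.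
Qed.

(** The factors of d2 are stripped off: with F = c + (z - a) G, the part coming from [c] is in [E]
    by shift invariance, the other by the previous stage. *)
Lemma invariant_subspace_full F : H F -> E F.
Proof.
have : forall a, a \in d2 -> `|a| < 1.
  by move=> a; rewrite mem_filter => /andP[_ /s'_disc].
have := E_d2; elim: d2 F => [|a l IH] F hE l1 hF; first exact: hE.
apply: IH => // [{hF}F hF|b bl]; last by rewrite l1 // in_cons bl orbT.
have a1 : `|a| < 1 by rewrite l1 // mem_head.
have [c [G [hG ->]]] := analytic_div a1 hF.
rewrite shift_prodD; apply: E_add; first exact: E_shift_prod (E_cst c).
by rewrite -shift_sub_prod; exact: hE.
Qed.

End InvariantSubspace.

(** * Subnormal compressions *)

Section SubnormalOperators.
Variables (R : realType).
Local Notation C := R[i].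
Variables (L : lmodType C) (ip : {dot L for Num.conj}).
Local Notation "'[ u , v ]" := (ip u v) : ring_scope.

Lemma dot_ext x y : (forall z, '[z, x] = '[z, y]) -> x = y.
Proof.
move=> h; apply/subr0_eq/eqP; rewrite -(dnorm_eq0 ip) dotBr.
by rewrite h subrr.
Qed.

Lemma adjoint_linear (T T' : L -> L) : is_adjoint ip T T' -> linear T'.
Proof.
move=> adj a x y; apply: dot_ext => z.
by rewrite dotDr dotZr -!adj dotDr dotZr.
Qed.

(* For a normal extension [N] of [T], the kernel of the self-commutator of [T]
   consists of the vectors at which the adjoint of [N] extends that of [T]. *)
Lemma subnormal_selfcommutator (T T' : L -> L) :
  subnormal_operator ip T -> is_adjoint ip T T' ->
  bounded_operator ip T /\ exists E : L -> Prop,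
    [/\ forall a x y, E x -> E y -> E (a *: x + y),
        forall x, '[T' x, T' x] <= '[T x, T x],
        forall x, E x <-> '[T' x, T' x] = '[T x, T x],
        forall x, E x -> E (T x) &
        forall x, E x -> T' (T x) = T (T' x)].
Proof.
move=> [K [ipK [_ [V [N [isoV [bN [N' [adjN comm]]] ext]]]]]] adj.
have iso x y : ipK (V x) (V y) = '[x, y] := isoV x y.
have V_inj x y : V x = V y -> x = y.
  move=> e; apply/subr0_eq/eqP; rewrite -(dnorm_eq0 ip) -iso linearB e subrr.
  by apply/eqP; exact: dot0l.
have [linN [B hB]] := bN.
have linT : linear T.
  by move=> a x y; apply: V_inj; rewrite -ext !linearP linN !ext.
have linT' := adjoint_linear adj.
have linN' a x y : N' (a *: x + y) = a *: N' x + N' y.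
  apply/subr0_eq/eqP; rewrite -(dnorm_eq0 ipK); apply/eqP.
  set u := _ - _; have h z : ipK z u = 0.
    rewrite /u dotBr dotDr dotZr -!adjN dotDr dotZr.
    by rewrite subrr.
  exact: h.
have normN x : ipK (N' x) (N' x) = ipK (N x) (N x).
  by rewrite -adjN -comm dotC adjN -dotC -adjN dotC -adjN -dotC.
have TT x : ipK (N' (V x)) (V (T' x)) = '[T' x, T' x].
  by rewrite dotC -adjN ext iso adj -dotC.
(* [V (T' x)] is the projection of [N' (V x)] on the image of [V], and normality gives [N'] and [N]
   the same norms. This yields hyponormality and describes its equality case. *)
have gap x : ipK (N' (V x) - V (T' x)) (N' (V x) - V (T' x)) =
    '[T x, T x] - '[T' x, T' x].
  rewrite dnormB TT normN ext !iso -dotC.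
  by rewrite opprD addrA addrK.
split.
  split => //; exists B => x.
  by rewrite -!iso -ext; exact: hB.
exists (fun x => N' (V x) = V (T' x)); split.
- by move=> a x y ex ey; rewrite linearP linN' ex ey linT' linearP.
- by move=> x; rewrite -subr_ge0 -gap dnorm_ge0.
- move=> x; split => [e|e].
    by apply/eqP; rewrite eq_sym -subr_eq0 -gap e subrr dot0l.
  by apply/subr0_eq/eqP; rewrite -(dnorm_eq0 ipK) gap e subrr.
(* Commuting [N'] past [N] keeps the vector in the image of [V]; hence its preimage [T (T' x)] must
   be [T' (T x)]. *)
- move=> x ex; have e1 : N' (V (T x)) = V (T (T' x)).
    by rewrite -ext comm ex ext.
  rewrite e1; congr (V _); apply: dot_ext => z.
  by rewrite -adj -!iso -e1 -adjN !ext.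
move=> x ex; have e1 : N' (V (T x)) = V (T (T' x)).
  by rewrite -ext comm ex ext.
apply: dot_ext => z.
by rewrite -adj -!iso -e1 -adjN !ext.
Qed.

End SubnormalOperators.

(** * The selfcommutator form of a multiplier *)

Section SubnormalMultiplier.
Variables (R : realType) (n : nat).
Local Notation C := R[i].
Variables (L : lmodType C) (ip : {dot L for Num.conj}).
Variable S : bilateral_shift n ip.
Local Notation "'[ u , v ]" := (ip u v) : ring_scope.
Local Notation Z := (shift S).
Local Notation D := (shift_sub S).
Local Notation W := (shift_prod S).
Local Notation H := (analytic S).

Variables M M' : {linear L -> L}.
Hypothesis MZ : forall F, M (Z F) = Z (M F).
Hypothesis M'Z : forall F, M' (Z F) = Z (M' F).
Let Q F := '[M F, M F] - '[M' F, M' F].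

(** On the circle |1 - conj(a) z| = |z - a|; in abstract form only the isometry of the shift
    enters. *)
Lemma norm_blaschke a X :
  '[X - a^* *: Z X, X - a^* *: Z X] = '[D a X, D a X].
Proof.
rewrite shift_subE !dotBl !dotBr !dotZl !dotZr shift_isometry conjCK.
move: '[X, X] '[X, Z X] '[Z X, X] (a^*) => p q r b; ring.
Qed.

Let Q_blaschke a X : Q (X - a^* *: Z X) = Q (D a X).
Proof.
have lin (N : {linear L -> L}) : (forall F, N (Z F) = Z (N F)) ->
    '[N (X - a^* *: Z X), N (X - a^* *: Z X)] = '[N (D a X), N (D a X)].
  move=> NZ; rewrite linearB [N (_ *: _)]linearZ /= NZ norm_blaschke.
  by rewrite shift_sub_comm.
by rewrite /Q (lin M MZ) (lin M' M'Z).
Qed.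

Hypothesis Q_analytic : forall F, H F -> H (M F) -> H (M' F) -> 0 <= Q F.

(* Dividing out a Blaschke factor changes neither [|M F|] nor [|M' F|]. *)
Lemma selfcommutator_ge0 s : (forall a, a \in s -> `|a| < 1) ->
  (forall F, H F -> H (W s (M F))) -> (forall F, H F -> H (W s (M' F))) ->
  forall F, H F -> 0 <= Q F.
Proof.
move=> s1 hM hM'.
(* On multiples of [W s] both images are analytic, so the hypothesis on [Q] applies; the factors are
   then replaced by invertible ones. *)
have : forall F, H F -> 0 <= Q (W s F).
  move=> F hF; apply: Q_analytic; first exact: analytic_shift_prod.
    by rewrite shift_prod_comm //; exact: hM.
  by rewrite shift_prod_comm //; exact: hM'.
elim: s s1 {hM hM'} => [_ hs|a s IH s1 hs]; first exact: hs.
apply: IH => [b bs|F hF]; first by rewrite s1 // in_cons bs orbT.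
have a1 : `|a| < 1 by rewrite s1 // mem_head.
have [X [hX ->]] := inv_one_sub_shift a1 hF.
have -> : W s (X - a^* *: Z X) = W s X - a^* *: Z (W s X).
  by rewrite linearB linearZ /= shift_prod_shift.
by rewrite Q_blaschke; exact: hs.
Qed.

Variable U : 'I_n -> 'I_n -> L -> L.
Hypothesis U_analytic : forall i j F, H F -> H (U i j F).
Hypothesis U_sum : forall F, \sum_i U i i F = F.
Hypothesis U_trace : forall i F, \sum_j Q (U j i F) = 0.

(** Nonnegative terms with sum zero vanish, so [Q] is zero on each [U i i F]. The vectors where a
    nonnegative quadratic form vanishes are closed under addition, by the parallelogram identity,
    and these pieces add up to [F]. *)
Lemma norm_multiplier_adj :
  (forall F, H F -> 0 <= Q F) -> forall F, H F -> '[M F, M F] = '[M' F, M' F].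
Proof.
move=> Q0 F hF; apply/subr0_eq; rewrite -/(Q F) -(U_sum F).
have Qi i : Q (U i i F) = 0.
  have h j : true -> 0 <= Q (U j i F) by move=> _; apply/Q0/U_analytic.
  have := psumr_eq0P (F := fun j => Q (U j i F)) (P := xpredT) h (U_trace i F).
  exact.
have add x y : H x -> H y -> Q x = 0 -> Q y = 0 -> Q (x + y) = 0.
  move=> hx hy qx qy.
  have par (N : {linear L -> L}) :
      '[N (x + y), N (x + y)] + '[N (x - y), N (x - y)] =
      ('[N x, N x] + '[N y, N y]) *+ 2.
    rewrite [N (x + y)]linearD [N (x - y)]linearB /= !dotBl !dotBr !dotDl !dotDr.
    by move: '[N x, N x] '[N y, N y] '[N x, N y] '[N y, N x] => p q r t; ring.
  have parQ : Q (x + y) + Q (x - y) = (Q x + Q y) *+ 2.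
    rewrite /Q [LHS]addrACA -opprD !par.
    by move: '[M x, M x] '[M' x, M' x] '[M y, M y] '[M' y, M' y] => p q r t; ring.
  have := Q0 _ (analyticD hx hy); have := Q0 _ (analyticB hx hy).
  move: parQ; rewrite qx qy addr0 mul0rn => /eqP; rewrite addrC addr_eq0 => /eqP ->.
  by rewrite oppr_ge0 => le0 ge0; apply/eqP; rewrite eq_le le0 ge0.
suff [] : Q (\sum_i U i i F) = 0 /\ H (\sum_i U i i F) by [].
apply: (big_ind (fun x => Q x = 0 /\ H x)).
- split; last exact: analytic0.
  by rewrite /Q [M 0]linear0 [M' 0]linear0 !dot0l subrr.
- by move=> x y [qx hx] [qy hy]; split; [exact: add | exact: analyticD].
by move=> i _; split; [exact: Qi | exact: U_analytic].
Qed.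

End SubnormalMultiplier.

(** * Normality of a subnormal compression *)

Section NormalCompression.
Variables (R : realType) (n : nat).
Local Notation C := R[i].
Variables (L : lmodType C) (ip : {dot L for Num.conj}).
Variable S : bilateral_shift n ip.
Local Notation "'[ u , v ]" := (ip u v) : ring_scope.
Local Notation Z := (shift S).
Local Notation kap := (cst_of S).
Local Notation D := (shift_sub S).
Local Notation W := (shift_prod S).
Local Notation H := (analytic S).

Variables (M M' : {linear L -> L}) (U : 'I_n -> 'I_n -> L -> L).
Variables (s s' : seq C) (a0 : C).
Variables (H0 : lmodType C) (ip0 : {dot H0 for Num.conj}).
Variables (incl : {linear H0 -> L}) (T T' : H0 -> H0).
Hypothesis MZ : forall F, M (Z F) = Z (M F).
Hypothesis M'Z : forall F, M' (Z F) = Z (M' F).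
Hypothesis M_adj : forall F G, '[M F, G] = '[F, M' G].
Hypothesis U_analytic : forall i j F, H F -> H (U i j F).
Hypothesis U_sum : forall F, \sum_i U i i F = F.
Hypothesis U_trace : forall i F, \sum_j ('[M (U j i F), M (U j i F)]
  - '[M' (U j i F), M' (U j i F)]) = 0.
Hypothesis s_disc : forall a, a \in s -> `|a| < 1.
Hypothesis s'_disc : forall a, a \in s' -> `|a| < 1.
Hypothesis a0s : a0 \in s.
Hypothesis M'_analytic : forall F, H F -> H (W s' (M' F)).
Hypothesis M_analytic : forall F, H F -> H (W s (M F)).
Hypothesis M_val : forall a c, a \in s ->
  exists c' G, H G /\ W s (M (kap c')) = kap c + D a G.
Hypothesis incl_analytic : forall x, H (incl x).
Hypothesis incl_onto : forall F, H F -> exists x, F = incl x.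
Hypothesis incl_dot : forall x y, ip0 x y = '[incl x, incl y].
Hypothesis T_proj : forall x, coanalytic S (M (incl x) - incl (T x)).
Hypothesis T'_proj : forall x, coanalytic S (M' (incl x) - incl (T' x)).
Hypothesis T_subnormal : subnormal_operator ip0 T.

Let compression_adjoint : is_adjoint ip0 T T'.
Proof.
move=> x y; rewrite /= (incl_dot (T x)) (incl_dot x).
have := T_proj x (incl_analytic y); rewrite dotBl => /subr0_eq <-.
have := T'_proj y (incl_analytic x); rewrite dotBl => /subr0_eq h.
by rewrite M_adj [RHS]dotC -h -dotC.
Qed.

Let proj_uniq (F : L) h h' : H h -> H h' -> coanalytic S (F - h) ->
  coanalytic S (F - h') -> h = h'.
Proof.
move=> hh hh' r r'; apply/subr0_eq/eqP; rewrite -(dnorm_eq0 ip).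
have hd : H (h - h') by exact: analyticB.
have e : h - h' = (F - h') - (F - h) by rewrite opprB [RHS]addrC addrA subrK.
by rewrite {1}e dotBl r // r' // subrr.
Qed.

Let norm_proj F h : H h -> coanalytic S (F - h) ->
  '[F, F] = '[h, h] + '[F - h, F - h].
Proof.
move=> hh r; rewrite -{1 2}(subrK h F); move: (F - h) r => u r.
have uh : '[u, h] = 0 by exact: r.
have hu : '[h, u] = 0 by rewrite dotC uh conjC0.
by rewrite dotDl !dotDr uh hu addr0 add0r addrC.
Qed.

Lemma compression_normal : normal_operator ip0 T.
Proof.
have [bT [E [E_lin hypo E_eq E_T E_comm]]] :=
  subnormal_selfcommutator T_subnormal compression_adjoint.
have ip0E x : ip0 x x = '[incl x, incl x] by exact: incl_dot.
have T_in x : H (M (incl x)) -> M (incl x) = incl (T x).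
  move=> h; apply: (@proj_uniq (M (incl x))) => //.
  by rewrite subrr; exact: coanalytic0.
have T'_in x : H (M' (incl x)) -> M' (incl x) = incl (T' x).
  move=> h; apply: (@proj_uniq (M' (incl x))) => //.
  by rewrite subrr; exact: coanalytic0.
have ss'_disc a : a \in s ++ s' -> `|a| < 1.
  by rewrite mem_cat => /orP[/s_disc|/s'_disc].
have norm_eq F : H F -> '[M F, M F] = '[M' F, M' F].
  apply: (norm_multiplier_adj U_analytic U_sum U_trace).
  apply: (selfcommutator_ge0 MZ M'Z _ ss'_disc) => [{}F hF hMF hM'F|{}F hF|{}F hF].
  - have [x e] := incl_onto hF; rewrite e in hMF hM'F *.
    by rewrite (T_in _ hMF) (T'_in _ hM'F) -!ip0E subr_ge0; exact: hypo.
  - rewrite shift_prod_cat shift_prodC; apply: analytic_shift_prod.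
    exact: M_analytic.
  - by rewrite shift_prod_cat; apply: analytic_shift_prod; exact: M'_analytic.
pose EL F := exists2 x, F = incl x & E x.
have EL_full : forall F, H F -> EL F.
  apply: (invariant_subspace_full (M := M) (M' := M') (s := s) (s' := s')
    (a0 := a0)) => //.
  - by move=> F [x -> _].
  - move=> a F G [x -> ex] [y -> ey]; exists (a *: x + y); last exact: E_lin.
    by rewrite linearP.
  (* Here |T' x| = |M' F| = |M F|, which is at least |T x|; hyponormality gives the opposite
     inequality. *)
  - move=> F hF hM'F; have [x e] := incl_onto hF; rewrite e in hF hM'F *.
    exists x => //; apply/E_eq/eqP; rewrite eq_le hypo /= !ip0E.
    rewrite -(T'_in _ hM'F) -(norm_eq _ hF) (norm_proj _ (T_proj x)) //.
    by rewrite lerDl dnorm_ge0.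
  (* Here |M' F| = |M F| = |T x| = |T' x| for the multiple of [W s] at hand, so by Pythagoras the
     part of its image under [M'] orthogonal to H is zero. *)
  - move=> F hF [x e ex]; have hW := M_analytic hF.
    have hWF := analytic_shift_prod s hF.
    rewrite -shift_prod_comm // e in hW hWF *.
    have : '[M' (incl x) - incl (T' x), M' (incl x) - incl (T' x)] = 0.
      apply: (addrI '[incl (T' x), incl (T' x)]).
      rewrite -(norm_proj _ (T'_proj x)) // -(norm_eq _ hWF) (T_in _ hW) addr0.
      by rewrite -!ip0E; apply/esym/E_eq.
    move/eqP; rewrite dnorm_eq0 subr_eq0 => /eqP ->; exact: incl_analytic.
  - move=> F h r [x -> ex] hh hr e; exists (T x); last exact: E_T.
    apply: (@proj_uniq (M (incl x))) => //.
    by rewrite e addrC addKr.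
split => //; exists T'; split => [|x]; first exact: compression_adjoint.
have [y e Ey] := EL_full _ (incl_analytic x).
have -> : x = y.
  apply/subr0_eq/eqP; rewrite -(dnorm_eq0 ip0) ip0E linearB e subrr.
  by apply/eqP; exact: dot0l.
exact: E_comm.
Qed.

End NormalCompression.

(** * The shift on the circle *)

Section TrigIntegrals.
Variable R : realType.
Local Notation C := R[i].
Local Notation circ := (circ R).
Import numFieldNormedType.Exports.
Local Open Scope classical_set_scope.

Lemma circ_Rintegral_derive (f F : R -> R) : continuous f ->
  (forall x, `|f x| <= 1) -> (forall x : R, is_derive x 1 F (f x)) ->
  F (pi *+ 2) = F 0 -> (\int[circ]_t f t) = 0.
Proof.
move=> cf f1 dF F0.
have mf : measurable_fun [set: R] f by exact: continuous_measurable_fun.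
have intf : circ.-integrable setT (EFin \o f).
  by apply/Lfun1_integrable/Lfun_bounded.
have int1 : circ.-integrable setT (EFin \o cst (1 : R)).
  exact: finite_measure_integrable_cst.
have f1' x : 0 <= 1 + f x.
  by rewrite -lerBlDl sub0r; have := f1 x; rewrite ler_norml => /andP[].
(* The formula for integrals against the uniform law asks for a nonnegative integrand, so 1 is added
   to [f] and its integral subtracted at the end. *)
have dF1 (x : R) : is_derive x 1 (fun t : R => t + F t) (1 + f x).
  by apply: is_deriveD.
have cF1 : continuous (fun t : R => t + F t).
  move=> x; apply: differentiable_continuous; apply/derivable1_diffP.
  exact: ex_derive.
have cf1 : continuous (fun t : R => 1 + f t).
  by move=> x; apply: cvgD; [exact: cvg_cst | exact: cf].
have ftc : (\int[lebesgue_measure]_(x in `[0%R, (pi *+ 2)%R]) (1 + f x)%:E =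
    (pi *+ 2 + F (pi *+ 2))%:E - (0 + F 0)%:E)%E.
  apply: (@continuous_FTC2 _ (fun t => 1 + f t) (fun t => t + F t)).
  - exact: two_pi_gt0.
  - exact: continuous_subspaceT.
  - split.
    + by move=> x _; apply: ex_derive.
    + by apply: cvg_at_right_filter; exact: cF1.
    + by apply: cvg_at_left_filter; exact: cF1.
  - by move=> x _; rewrite derive1E; exact: derive_val.
have tot : (\int[circ]_x (1 + f x)%:E = 1%:E)%E.
  rewrite /circ integral_uniform.
  - rewrite ftc F0 -EFinB opprD addrACA subrr addr0 subr0 -EFinM.
    by rewrite mulVf // gt_eqF // two_pi_gt0.
  - apply/measurable_EFinP; exact: continuous_measurable_fun.
  - by move=> x; rewrite lee_fin.
have : \int[circ]_x (1 + f x) = 1 + \int[circ]_x f x.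
  rewrite RintegralD //; congr (_ + _).
  rewrite Rintegral_cst // mul1r.
  exact: (congr1 (@fine R) (@probability_setT _ _ _ circ)).
rewrite /Rintegral tot /= -[X in X = _]addr0 => /addrI /esym.
exact.
Qed.

Lemma periodicn0 (f : R -> R) m : (forall u, f (u + pi *+ 2) = f u) ->
  f (m%:R * (pi *+ 2)) = f 0.
Proof.
move=> pf; elim: m => [|m IH]; first by rewrite mul0r.
by rewrite -natr1 mulrDl mul1r pf.
Qed.

Lemma circ_int_exp m : circ_int (fun z : C => z ^+ m.+1) = 0.
Proof.
have m0 : m.+1%:R != 0 :> R by rewrite pnatr_eq0.
have dm (x : R) : is_derive x 1 (fun t : R => m.+1%:R * t) m.+1%:R.
  rewrite -[X in is_derive _ _ _ X]mulr1.
  apply: is_deriveZ.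
have cm : continuous (fun t : R => m.+1%:R * t).
  by move=> x; apply: cvgM; [exact: cvg_cst | exact: cvg_id].
rewrite /circ_int; apply/eqP; rewrite eq_complex; apply/andP; split; apply/eqP.
- transitivity (\int[circ]_t cos (m.+1%:R * t)).
    by apply: eq_Rintegral => t _; rewrite cisX.
  apply: (@circ_Rintegral_derive _ (fun t => m.+1%:R^-1 * sin (m.+1%:R * t))).
  + by move=> x; apply: continuous_comp; [exact: cm | exact: continuous_cos].
  + by move=> x; exact: cos_max.
  + move=> x; have dsin := is_derive1_comp (is_derive_sin (m.+1%:R * x)) (dm x).
    apply: is_derive_eq (is_deriveZ m.+1%:R^-1 dsin) _.
    by rewrite -[_ *: _]/(_ * _) mulrCA mulVf // mulr1.
  + by rewrite (periodicn0 _ (@sinD2pi R)) mulr0.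
- transitivity (\int[circ]_t sin (m.+1%:R * t)).
    by apply: eq_Rintegral => t _; rewrite cisX.
  apply: (@circ_Rintegral_derive _ (fun t => - m.+1%:R^-1 * cos (m.+1%:R * t))).
  + by move=> x; apply: continuous_comp; [exact: cm | exact: continuous_sin].
  + by move=> x; exact: sin_max.
  + move=> x; have dcos := is_derive1_comp (is_derive_cos (m.+1%:R * x)) (dm x).
    apply: is_derive_eq (is_deriveZ (- m.+1%:R^-1) dcos) _.
    rewrite -[_ *: _]/(_ * _) !mulNr mulrN opprK.
    by rewrite mulrCA mulVf // mulr1.
  + by rewrite (periodicn0 _ (@cosD2pi R)) mulr0.
Qed.
End TrigIntegrals.

(** * Bounded functions on the circle *)

Section CircleFunctions.
Variable R : realType.
Local Notation C := R[i].
Local Notation circ := (circ R).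
Import numFieldNormedType.Exports.
Local Open Scope classical_set_scope.

Lemma Lfun_oo_of_bounded (u : R -> R) M : measurable_fun [set: R] u ->
  (forall t, `|u t| <= M) -> u \in Lfun circ +oo%E.
Proof.
move=> mu uM; apply/andP; split; rewrite inE //= /finite_norm unlock.
case: ifP => // _; apply: (@le_lt_trans _ _ M%:E); last exact: ltry.
by apply/ess_supP/aeW => t /=; rewrite lee_fin; exact: uM.
Qed.

Lemma Lcirc_id : (fun z : C => z) \in Lcirc +oo%E.
Proof. by apply: eq_Lcirc (Lcirc_exp 1 (leey _)) => z; rewrite expr1. Qed.

(** The inverse is conj(z - a) / |z - a|^2, and on the circle |z - a| is at least the distance of
    |a| to 1. *)
Lemma Lcirc_inv_sub (a : C) : `|a| != 1 ->
  (fun z : C => (z - a)^-1) \in Lcirc +oo%E.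
Proof.
move=> a1; pose f t : R :=
  (cos t - complex.Re a) ^+ 2 + (sin t - complex.Im a) ^+ 2.
have fE t : `|cis t - a| ^+ 2 = (f t)%:C%C.
  by rewrite -add_Re2_Im2 /f; case: (a).
pose d : R := complex.Re `|1 - `|a| |.
have dE : `|1 - `|a| | = d%:C%C by apply/esym/RRe_real; rewrite ger0_real.
have d0 : 0 < d by rewrite -ltcR -dE normr_gt0 subr_eq0 eq_sym.
have fd t : d ^+ 2 <= f t.
  rewrite -lecR -fE rmorphXn /= -dE lerXn2r ?nnegrE //.
  by rewrite -(norm_cis t); exact: ler_dist_dist.
have f0 t : 0 < f t by apply: lt_le_trans (fd t); rewrite exprn_gt0.
have cf : continuous f.
  move=> t; apply: cvgD; apply: cvgM; apply: cvgB;
    try exact: cvg_cst; [exact: continuous_cos|exact: continuous_cos|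
    exact: continuous_sin|exact: continuous_sin].
have finv : (fun t => (f t)^-1) \in Lfun circ +oo%E.
  apply: (@Lfun_oo_of_bounded _ (d ^- 2)) => [|t].
    apply: continuous_measurable_fun => t; apply: cvgV; last exact: cf.
    by rewrite gt_eqF.
  by rewrite ger0_norm ?invr_ge0 ?(ltW (f0 t)) // lef_pV2 ?posrE ?exprn_gt0.
have gL : (fun z : C => `|z - a| ^- 2) \in Lcirc +oo%E.
  apply/andP; split.
    by apply: eq_Lfun finv => t; rewrite fE -fmorphV.
  have /andP[_] := Lcirc0 (leey 1) : (fun=> 0 : C) \in Lcirc +oo%E.
  by apply: eq_Lfun => t; rewrite fE -fmorphV.
have cL : (fun z : C => (z - a)^*) \in Lcirc +oo%E.
  apply: Lcirc_conj; first exact: leey.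
  have := Lcirc_submod (leey _) 1 Lcirc_id (Lcirc_cst (- a) (leey _)).
  by apply: eq_Lcirc => z; rewrite mul1r.
have := Lcirc_mul_oo (or_intror erefl) gL cL.
by apply: eq_Lcirc => z; rewrite -invC_norm.
Qed.

Lemma circ_int_cst (a : C) : circ_int (fun=> a) = a.
Proof.
have c1 : \int[circ]_x 1 = 1.
  rewrite Rintegral_cst // mul1r.
  exact: (congr1 (@fine R) (@probability_setT _ _ _ circ)).
have int1 : circ.-integrable setT (EFin \o cst (1 : R)).
  exact: finite_measure_integrable_cst.
have h (x : R) : \int[circ]_t x = x.
  by rewrite -[RHS]mulr1 -[X in _ = _ * X]c1 -RintegralZl // mulr1.
by rewrite /circ_int !h; case: a.
Qed.

Lemma Lcirc_oo1 (m : C -> C) : m \in Lcirc +oo%E -> m \in Lcirc 1.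
Proof. by move/Lcirc_oo2/Lcirc21. Qed.

End CircleFunctions.

(** * Square-integrable functions as a model of the bilateral shift *)

Section CircleModel.
Variables (R : realType) (n : nat).
Local Notation C := R[i].
Local Notation L2 := (L2 R n).

Definition circ_shift : L2 -> L2 := opS (fun z => z).

Fact circ_shift_linear : linear circ_shift.
Proof. exact: opS_linear (Lcirc_id R). Qed.
HB.instance Definition _ :=
  GRing.isLinear.Build C L2 L2 *:%R circ_shift circ_shift_linear.

Definition circ_cst (v : 'cV[C]_n) : L2 := L2class (fun=> v).

Lemma circ_cstE v : ae_eq_circ (L2fun (circ_cst v)) (fun=> v).
Proof. by apply: L2classE => i; apply: Lcirc_cst; rewrite lee_fin ler1n. Qed.

Fact circ_cst_linear : linear circ_cst.
Proof.
move=> a v w; apply: L2eqP; apply: ae_circ_trans (circ_cstE _) _.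
apply: ae_circ_trans (ae_circ_sym (L2funP _ _ _)).
apply: ae_circ2 (circ_cstE v) (circ_cstE w) => t e1 e2.
by congr (_ + _); [congr (_ *: _); exact: esym e1 | exact: esym e2].
Qed.
HB.instance Definition _ :=
  GRing.isLinear.Build C 'cV[C]_n L2 *:%R circ_cst circ_cst_linear.

Lemma circ_shift_iter k F : iter k circ_shift F = opS (fun z => z ^+ k) F.
Proof.
elim: k => [|k IH].
  have -> : (fun z : C => z ^+ 0) = (fun=> 1) by apply/funext => z; rewrite expr0.
  by rewrite opS_cst scale1r.
rewrite iterS IH /circ_shift opS_comp; first last.
- exact: Lcirc_exp (leey _).
- exact: Lcirc_id.
by congr (opS _ F); apply/funext => z; rewrite exprS.
Qed.

Lemma L2ip_class (F G : L2) (f g : C -> 'cV[C]_n) :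
  (fun z => \sum_i f z i 0 * (g z i 0)^*) \in Lcirc 1 ->
  ae_eq_circ (L2fun F) f -> ae_eq_circ (L2fun G) g ->
  L2ip F G = circ_int (fun z => \sum_i f z i 0 * (g z i 0)^*).
Proof.
move=> fg Ff Gg; apply: circ_int_ae => //; first exact: L2ip_Lcirc.
apply: ae_circ2 Ff Gg => t e1 e2; apply: eq_bigr => i _; congr (_ * _^*).
  exact: (congr1 (fun v : 'cV_n => v i 0) e1).
exact: (congr1 (fun v : 'cV_n => v i 0) e2).
Qed.

Lemma L2ip_opS_cst (m : C -> C) c d : m \in Lcirc +oo%E ->
  L2ip (opS m (circ_cst c)) (circ_cst d) =
  circ_int m * \sum_i c i 0 * (d i 0)^*.
Proof.
move=> mL; have m1 := Lcirc_oo1 mL; set q := \sum_i _.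
have e : (fun z => \sum_i (m z *: c) i 0 * (d i 0)^*) = (fun z => q * m z + 0).
  apply/funext => z; rewrite addr0 mulr_suml; apply: eq_bigr => i _.
  by rewrite mxE -mulrA mulrC.
have z1 : (fun=> 0 : C) \in Lcirc 1 by exact: Lcirc0.
rewrite (@L2ip_class _ _ (fun z => m z *: c) (fun=> d)).
- by rewrite e circ_intP // circ_int_cst addr0 mulrC.
- by rewrite e; exact: Lcirc_submod.
- apply: ae_circ_trans (opME _ (L_mx_scalar mL)) _.
  apply: ae_circ2 (circ_cstE c) (circ_cstE c) => t e1 _.
  by rewrite mul_scalar_mx; congr (_ *: _); exact: e1.
exact: circ_cstE.
Qed.

Lemma L2ip_opS_delta (m : C -> C) F i : m \in Lcirc +oo%E ->
  L2ip (opS m F) (circ_cst (delta_mx i 0)) =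
  circ_int (fun z => m z * L2fun F z i 0).
Proof.
move=> mL.
have e : (fun z => \sum_j (m z *: L2fun F z) j 0 *
    ((delta_mx i 0 : 'cV[C]_n) j 0)^*) = (fun z => m z * L2fun F z i 0).
  apply/funext => z; rewrite (bigD1 i) //= !mxE !eqxx conjC1 mulr1.
  by rewrite big1 ?addr0 // => j ji; rewrite !mxE (negbTE ji) conjC0 mulr0.
rewrite (@L2ip_class _ _ (fun z => m z *: L2fun F z) (fun=> delta_mx i 0)).
- by rewrite e.
- rewrite e; apply: Lcirc21; apply: Lcirc_mul_oo => //; first by left.
  exact: L2fun_L2.
- apply: ae_circ_trans (opME _ (L_mx_scalar mL)) _.
  by apply/aeW => t; rewrite mul_scalar_mx.
exact: circ_cstE.
Qed.

Lemma opS_eq_on_circle (m k : C -> C) (F : L2) :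
  m \in Lcirc +oo%E -> k \in Lcirc +oo%E ->
  (forall t, m (cis t) = k (cis t)) -> opS m F = opS k F.
Proof. by move=> mL kL e; apply: opS_ae => //; apply/aeW => t; exact: e. Qed.

Let Lconj : (fun z : C => z^*) \in Lcirc +oo%E.
Proof. exact: Lcirc_conj (leey _) (Lcirc_id R). Qed.

Let L1 : (fun=> 1 : C) \in Lcirc +oo%E.
Proof. exact: Lcirc_cst (leey _). Qed.

Definition circ_unshift : L2 -> L2 := opS (fun z => z^*).

Definition circ_resolvent (a : C) : L2 -> L2 := opS (fun z => (z - a)^-1).

Lemma cis_conjM t : (cis t : C)^* * cis t = 1.
Proof.
by rewrite conj_cis mulVf // -normr_eq0 norm_cis oner_eq0.
Qed.

Lemma circ_shiftK : cancel circ_shift circ_unshift.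
Proof.
move=> F; rewrite /circ_shift /circ_unshift opS_comp //; last exact: Lcirc_id.
rewrite -[RHS]scale1r -opS_cst; apply: opS_eq_on_circle => //.
  exact: Lcirc_mul_oo (or_intror erefl) Lconj (Lcirc_id R).
exact: cis_conjM.
Qed.

Lemma circ_unshiftK : cancel circ_unshift circ_shift.
Proof.
move=> F; rewrite /circ_shift /circ_unshift opS_comp //; last exact: Lcirc_id.
rewrite -[RHS]scale1r -opS_cst; apply: opS_eq_on_circle => //.
  exact: Lcirc_mul_oo (or_intror erefl) (Lcirc_id R) Lconj.
by move=> t; rewrite mulrC; exact: cis_conjM.
Qed.

Lemma circ_shift_adj (F G : L2) :
  L2ip (circ_shift F) G = L2ip F (circ_unshift G).
Proof. by rewrite /circ_shift opS_adj //; exact: Lcirc_id. Qed.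

Lemma circ_cst_wandering k c d :
  L2ip (iter k.+1 circ_shift (circ_cst c)) (circ_cst d) = 0.
Proof.
rewrite circ_shift_iter L2ip_opS_cst; last exact: Lcirc_exp (leey _).
by rewrite circ_int_exp mul0r.
Qed.

Lemma circ_cst_dot c d :
  L2ip (circ_cst c) (circ_cst d) = \sum_i c i 0 * (d i 0)^*.
Proof.
have := @L2ip_opS_cst (fun=> 1) c d L1.
by rewrite opS_cst scale1r circ_int_cst mul1r.
Qed.

Lemma Lcirc_sub (a : C) : (fun z : C => z - a) \in Lcirc +oo%E.
Proof.
have := Lcirc_submod (leey _) 1 (Lcirc_id R) (Lcirc_cst (- a) (leey _)).
by apply: eq_Lcirc => z; rewrite mul1r.
Qed.

Lemma circ_shift_subE a F : circ_shift F - a *: F = opS (fun z => z - a) F.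
Proof.
have := opSP 1 F (Lcirc_id R) (@Lcirc_cst R +oo%E (- a) (leey _)).
rewrite opS_cst scale1r scaleNr => <-; congr (opS _ F).
by apply/funext => z; rewrite mul1r.
Qed.

Lemma circ_resolventK a F : `|a| != 1 ->
  circ_shift (circ_resolvent a F) - a *: circ_resolvent a F = F.
Proof.
move=> a1; have iL := Lcirc_inv_sub a1.
rewrite circ_shift_subE /circ_resolvent opS_comp //; last exact: Lcirc_sub.
rewrite -[RHS]scale1r -opS_cst; apply: opS_eq_on_circle => //.
  exact: Lcirc_mul_oo (or_intror erefl) (Lcirc_sub a) iL.
move=> t; rewrite mulfV // subr_eq0.
by apply: contra a1 => /eqP <-; rewrite norm_cis.
Qed.

Definition circle_model : bilateral_shift n (@L2ip R n) :=
  @BilateralShift R n L2 (@L2ip R n) circ_shift circ_unshift circ_cst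
    circ_resolvent circ_shiftK circ_unshiftK circ_shift_adj
    circ_cst_wandering circ_cst_dot circ_resolventK.

Lemma analytic_hardyP F : analytic circle_model F <-> F \in @hardy_L2 R n.
Proof.
have coef k i : L2ip (iter k.+1 circ_shift F) (circ_cst (delta_mx i 0)) =
    fourier_coef (fun z => L2fun F z i 0) (Negz k).
  rewrite circ_shift_iter L2ip_opS_delta; last exact: Lcirc_exp (leey _).
  congr circ_int; apply/funext => z.
  by rewrite NegzE opprK mulrC.
split=> [hF|/forallP hF].
  apply/forallP => i; apply/andP; split; first exact: L2fun_L2.
  by apply/asboolP => -[//|k] _; rewrite -coef; exact: hF.
move=> k c; rewrite (@cst_of_dot_inj _ _ _ _ circle_model _ 0).
  by rewrite linear0; exact: dot0l.
move=> i; rewrite mxE [LHS]coef; have /andP[_ /asboolP] := hF i; exact.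
Qed.

End CircleModel.

(** * Rational multipliers *)

Section MeromorphicMultipliers.
Variables (R : realType) (n : nat).
Local Notation C := R[i].
Local Notation L2 := (L2 R n).
Local Notation S := (circle_model R n).
Local Notation Z := (shift S).
Local Notation H := (analytic S).
Local Notation W := (shift_prod S).

Definition opM_lin (Psi : C -> 'M[C]_n) (PL : L_mx +oo%E Psi) :
    {linear L2 -> L2} :=
  HB.pack (opM Psi) (GRing.isLinear.Build C L2 L2 *:%R (opM Psi) (opM_linear PL)).

Lemma opM_shift Psi F : L_mx +oo%E Psi -> opM Psi (Z F) = Z (opM Psi F).
Proof.
by move=> PL; rewrite /= /circ_shift -opS_opM //; exact: Lcirc_id.
Qed.

Lemma opM_shift_prod Psi s F : L_mx +oo%E Psi ->
  opM Psi (W s F) = W s (opM Psi F).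
Proof.
move=> PL; apply: (shift_prod_comm (M := opM_lin PL)) => G; exact: opM_shift.
Qed.

(* The poles of [m] in the disc are cleared by a polynomial. *)
Definition meromorphic (m : C -> C) : Prop :=
  m \in Lcirc +oo%E /\ exists s, (forall a, a \in s -> `|a| < 1) /\
    forall F : L2, H F -> H (W s (opS m F)).

Lemma meromorphic_ae m k : meromorphic m -> k \in Lcirc +oo%E ->
  ae_eq_circ m k -> meromorphic k.
Proof.
move=> [mL [s [s1 hs]]] kL mk; split; first exact: kL.
exists s; split; first exact: s1.
move=> F hF.
by rewrite -(opS_ae F mL kL mk); exact: hs.
Qed.

Lemma ae_on_circle T (m k : C -> T) :
  (forall t, m (cis t) = k (cis t)) -> ae_eq_circ m k.
Proof. by move=> h; apply/aeW => t; exact: h. Qed.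

Lemma Lcirc_on_circle p (m k : C -> C) :
  (forall t, m (cis t) = k (cis t)) -> m \in Lcirc p -> k \in Lcirc p.
Proof.
move=> h /andP[m1 m2]; apply/andP; split.
  by apply: eq_Lfun m1 => t; rewrite h.
by apply: eq_Lfun m2 => t; rewrite h.
Qed.

Lemma meromorphic_on_circle m k : meromorphic m ->
  (forall t, m (cis t) = k (cis t)) -> meromorphic k.
Proof.
move=> mm h; apply: (meromorphic_ae mm); last exact: ae_on_circle.
by apply: Lcirc_on_circle h _; have [] := mm.
Qed.

Lemma meromorphicP a m k : meromorphic m -> meromorphic k ->
  meromorphic (fun z => a * m z + k z).
Proof.
move=> [mL [s [s1 hs]]] [kL [s' [s1' hs']]].
split; first exact: Lcirc_submod (leey _) _ _ _ mL kL.
exists (s ++ s'); split => [b|F hF].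
  by rewrite mem_cat => /orP[/s1|/s1'].
rewrite opSP // [W _ _]linearP /=; apply: analyticP.
  by rewrite shift_prod_cat shift_prodC; apply: analytic_shift_prod; exact: hs.
by rewrite shift_prod_cat; apply: analytic_shift_prod; exact: hs'.
Qed.

Lemma meromorphicM m k : meromorphic m -> meromorphic k ->
  meromorphic (fun z => m z * k z).
Proof.
move=> [mL [s [s1 hs]]] [kL [s' [s1' hs']]].
split; first exact: Lcirc_mul_oo (or_intror erefl) mL kL.
exists (s ++ s'); split => [b|F hF].
  by rewrite mem_cat => /orP[/s1|/s1'].
rewrite -opS_comp // shift_prod_cat -opM_shift_prod; last exact: L_mx_scalar.
by apply: hs; exact: hs'.
Qed.

Lemma meromorphic_cst a : meromorphic (fun=> a).
Proof.
split; first exact: Lcirc_cst (leey _).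
by exists [::]; split => // F hF; rewrite opS_cst; exact: analyticZ.
Qed.

Lemma meromorphic_id : meromorphic (fun z => z).
Proof.
split; first exact: Lcirc_id.
by exists [::]; split => // F hF; exact: (@analytic_shift _ _ _ _ S).
Qed.

Lemma meromorphic_conj_id : meromorphic (fun z => z^*).
Proof.
split; first by apply: Lcirc_conj (leey _) (Lcirc_id R).
exists [:: 0]; split => [a|F hF].
  by rewrite inE => /eqP ->; rewrite normr0.
by rewrite /= shift_subE scale0r subr0 (@unshiftK _ _ _ _ S).
Qed.

Lemma meromorphic_inv b : `|b| != 1 -> meromorphic (fun z => (z - b)^-1).
Proof.
move=> b1; split; first exact: Lcirc_inv_sub.
have := b1; rewrite real_neqr_lt ?real1 ?normr_real // => /orP[b1'|b1'].
  exists [:: b]; split => [a|F hF]; first by rewrite inE => /eqP ->.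
  by rewrite /= (@shift_sub_resolvent _ _ _ _ S).
by exists [::]; split => // F hF; exact: (@analytic_resolvent _ _ _ _ S).
Qed.

(** Since conj(z) = 1/z on the circle, the conjugate of 1/(z - b) is z when b = 0, and otherwise
    -(1/conj b) z / (z - 1/conj b). *)
Lemma meromorphic_conj_inv b : `|b| != 1 ->
  meromorphic (fun z => ((z - b)^-1)^*).
Proof.
move=> b1; have [->|b0] := eqVneq b 0.
  apply: meromorphic_on_circle meromorphic_id _ => t.
  by rewrite subr0 fmorphV /= conj_cis invrK.
have b0' : b^* != 0 by rewrite fmorph_eq0.
have b1' : `|(b^*)^-1| != 1 by rewrite normfV norm_conjC invr_eq1.
apply: meromorphic_on_circle (meromorphicM
  (meromorphicM (meromorphic_cst (- (b^*)^-1)) meromorphic_id)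
  (meromorphic_inv b1')) _ => t.
have c0 : (cis t : C) != 0 by rewrite -normr_eq0 norm_cis oner_eq0.
have c1 : cis t - (b^*)^-1 != 0.
  by rewrite subr_eq0; apply: contra b1' => /eqP <-; rewrite norm_cis.
rewrite fmorphV rmorphB /= conj_cis.
have -> : (cis t)^-1 - b^* = - (b^* / cis t) * (cis t - (b^*)^-1).
  rewrite mulrBr !mulNr mulfVK // opprK mulrAC mulfV // mul1r.
  by rewrite addrC.
by rewrite invfM invrN invfM invrK !mulNr.
Qed.

End MeromorphicMultipliers.

(** * Poles on the unit circle *)

Section CirclePoles.
Variables (R : realType) (n : nat).
Local Notation C := R[i].
Local Notation circ := (circ R).

(** The equation z F = c + a F makes the coefficients of [F] of constant modulus on indices k >= 0
    and on indices k < 0. Both families vanish by Bessel, and then so does [c]. *)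
Lemma eigen_unimodular (L : lmodType C) (ip : {dot L for Num.conj})
    (S : bilateral_shift n ip) a F c : `|a| = 1 ->
  shift_sub S a F = cst_of S c ->
  c = 0 /\ forall d, ip F (cst_of S d) = 0.
Proof.
move=> a1 e; have ZF : shift S F = cst_of S c + a *: F by rewrite (shiftE S a) e.
have F0 d : ip F (cst_of S d) = 0.
  apply: (coef_growing_unshift (S := S)) => k.
  have -> : iter k (unshift S) F =
      a *: iter k.+1 (unshift S) F + iter k.+1 (unshift S) (cst_of S c).
    apply: (can_inj (iter_shiftK S k.+1)).
    rewrite iter_shift_linear !iter_unshiftK iterS iter_unshiftK.
    by rewrite ZF addrC.
  by rewrite dotDl dotZl cst_of_wandering_unshift addr0 normrM a1 mul1r.
split => //; apply: (cst_of_inj (S := S)) => d.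
have ZF0 : ip (shift S F) (cst_of S d) = 0.
  apply: (coef_growing_shift (S := S)) => k.
  have -> : iter k.+1 (shift S) (shift S F) =
      a *: iter k (shift S) (shift S F) + iter k.+1 (shift S) (cst_of S c).
    by rewrite {1}ZF addrC iter_shift_linear -iterSr.
  by rewrite dotDl dotZl cst_of_wandering addr0 normrM a1 mul1r.
by rewrite [cst_of S 0]linear0 dot0l -ZF0 ZF dotDl dotZl F0 mulr0 addr0.
Qed.

Hypothesis n0 : (0 < n)%N.
Let i0 : 'I_n := Ordinal n0.
Local Notation S := (circle_model R n).

(** Embeds scalar functions along one coordinate, so that results on the vector-valued model apply
    to them. *)
Definition axis_class (w : C -> C) : L2 R n :=
  L2class (fun z => w z *: delta_mx i0 0).

Lemma axis_classE w : w \in Lcirc 2%:E ->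
  ae_eq_circ (L2fun (axis_class w)) (fun z => w z *: delta_mx i0 0).
Proof.
move=> wL; apply: L2classE => i; have [->|ii] := eqVneq i i0.
  by apply: eq_Lcirc wL => z; rewrite !mxE !eqxx mulr1.
have h : (1 <= 2%:E :> \bar R)%E by rewrite lee_fin ler1n.
apply: eq_Lcirc (Lcirc0 h) => z.
by rewrite !mxE (negbTE ii) mulr0.
Qed.

Lemma unimodular_pole_cst (a c : C) (w : C -> C) : `|a| = 1 ->
  w \in Lcirc 2%:E -> ae_eq_circ (fun z => (z - a) * w z) (fun=> c) ->
  c = 0 /\ circ_int w = 0.
Proof.
move=> a1 wL e.
have := @eigen_unimodular _ _ S a (axis_class w) (c *: delta_mx i0 0) a1.
have -> : shift_sub S a (axis_class w) = cst_of S (c *: delta_mx i0 0).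
  rewrite shift_subE; apply: L2eqP.
  apply: ae_circ_trans (ae_circ_sym (circ_cstE _)).
  have -> : shift S (axis_class w) - a *: axis_class w =
      opS (fun z => z - a) (axis_class w) by exact: circ_shift_subE.
  apply: ae_circ_trans (opME _ (L_mx_scalar (Lcirc_sub a))) _.
  apply: ae_circ2 (axis_classE wL) e => t e1 e2.
  rewrite mul_scalar_mx -[X in _ = X *: _]e2 -scalerA; congr (_ *: _).
  exact: e1.
move=> /(_ erefl) [c0 h]; split.
  have := congr1 (fun v : 'cV[C]_n => v i0 0) c0.
  by rewrite !mxE !eqxx mulr1.
have L1 : (fun=> 1 : C) \in Lcirc +oo%E by exact: Lcirc_cst (leey _).
have := h (delta_mx i0 0); rewrite /= -[axis_class w]scale1r -opS_cst.
rewrite (L2ip_opS_delta _ _ L1) => <-; apply: circ_int_ae.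
- exact: Lcirc21.
- apply: Lcirc21; apply: Lcirc_mul_oo => //; first by left.
  exact: L2fun_L2.
apply: ae_circ2 (axis_classE wL) (axis_classE wL) => t e1 _.
rewrite mul1r; have := congr1 (fun v : 'cV[C]_n => v i0 0) e1.
by rewrite !mxE !eqxx mulr1 => ->.
Qed.

Local Open Scope classical_set_scope.

(** The indicator [w] of the point [a] satisfies (z - a) w = 0, so its mean, the measure of the set
    where [cis t = a], is zero by [unimodular_pole_cst]. *)
Lemma ae_neq_unimodular (a : C) : `|a| = 1 -> {ae circ, forall t, cis t != a}.
Proof.
move=> a1; pose A := [set t : R | cis t = a].
have AE : A = [set t | cos t = complex.Re a] `&` [set t | sin t = complex.Im a].
  apply/seteqP; split=> t /=; first by move=> <-.
  by case=> cx sx; rewrite /A /= /cis cx sx; case: (a).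
have mA : measurable (A : set (measurableTypeR R)).
  rewrite AE; apply: measurableI.
    rewrite -[X in measurable X]setTI.
    have mc := continuous_measurable_fun (@continuous_cos R).
    have := mc measurableT _ (measurable_set1 (complex.Re a)).
    exact.
  rewrite -[X in measurable X]setTI.
  have ms := continuous_measurable_fun (@continuous_sin R).
  have := ms measurableT _ (measurable_set1 (complex.Im a)).
  exact.
pose w (z : C) : C := (z == a)%:R.
have wA t : complex.Re (w (cis t)) = \1_A t.
  rewrite /w indicE; have -> : (t \in A) = (cis t == a).
    by apply/idP/eqP => [/set_mem|/mem_set].
  by case: (_ == _).
have wL : w \in Lcirc +oo%E.
  apply/andP; split.
    apply: (@eq_Lfun _ _ (\1_A)) => [t|]; first by rewrite wA.
    apply: (@Lfun_oo_of_bounded _ _ 1) => [|t]; first exact: measurable_indic.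
    by rewrite indicE; case: (_ \in _); rewrite ?normr1 ?normr0.
  have /andP[_] := Lcirc0 (leey 1) : (fun=> 0 : C) \in Lcirc +oo%E.
  by apply: eq_Lfun => t; rewrite /w; case: (_ == _).
have ew : ae_eq_circ (fun z => (z - a) * w z) (fun=> 0).
  apply/aeW => t; rewrite /w; have [->|_] := eqVneq (cis t) a.
    by rewrite subrr mul0r.
  by rewrite mulr0.
have [_ w0] := unimodular_pole_cst a1 (Lcirc_oo2 wL) ew.
have int0 : \int[circ]_t (\1_A t : R) = 0.
  have := congr1 (@complex.Re R) w0; rewrite /circ_int /= => <-.
  by apply: eq_Rintegral => t _; rewrite wA.
have A0 : circ A = 0%E.
  move: int0; rewrite /Rintegral integral_indic // setIT => fA.
  by rewrite -[LHS]fineK ?fA // fin_num_measure.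
suff : circ.-negligible (~` [set t | cis t != a]) by [].
have -> : ~` [set t | cis t != a] = A.
  by apply/seteqP; split=> t /=; [move/negP/negPn/eqP | move=> ->; rewrite eqxx].
by apply/negligibleP.
Qed.

End CirclePoles.

(** * Bounded rational functions as multipliers *)

Section RationalMultipliers.
Variables (R : realType) (n : nat).
Local Notation C := R[i].
Local Notation circ := (circ R).
Hypothesis n0 : (0 < n)%N.

Definition bimeromorphic (m : C -> C) : Prop :=
  meromorphic n m /\ meromorphic n (fun z => (m z)^*).

Lemma bimeromorphicP a m k : bimeromorphic m -> bimeromorphic k ->
  bimeromorphic (fun z => a * m z + k z).
Proof.
move=> [m1 m2] [k1 k2]; split; first exact: meromorphicP.
have := meromorphicP (a^*) m2 k2.
by congr meromorphic; apply/funext => z; rewrite rmorphD rmorphM.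
Qed.

Lemma bimeromorphicM m k : bimeromorphic m -> bimeromorphic k ->
  bimeromorphic (fun z => m z * k z).
Proof.
move=> [m1 m2] [k1 k2]; split; first exact: meromorphicM.
have := meromorphicM m2 k2.
by congr meromorphic; apply/funext => z; rewrite rmorphM.
Qed.

Lemma bimeromorphic_cst a : bimeromorphic (fun=> a).
Proof. by split; exact: meromorphic_cst. Qed.

Lemma bimeromorphic_id : bimeromorphic (fun z => z).
Proof. by split; [exact: meromorphic_id | exact: meromorphic_conj_id]. Qed.

Lemma bimeromorphic_inv b : `|b| != 1 -> bimeromorphic (fun z => (z - b)^-1).
Proof. by split; [exact: meromorphic_inv | exact: meromorphic_conj_inv]. Qed.

Lemma bimeromorphic_horner (p : {poly C}) : bimeromorphic (fun z => p.[z]).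
Proof.
elim/poly_ind: p => [|p c IH].
  have -> : (fun z : C => (0 : {poly C}).[z]) = (fun=> 0).
    by apply/funext => z; rewrite horner0.
  exact: bimeromorphic_cst.
have -> : (fun z : C => (p * 'X + c%:P).[z]) = (fun z => 1 * (p.[z] * z) + c).
  by apply/funext => z; rewrite hornerMXaddC mul1r.
apply: bimeromorphicP; last exact: bimeromorphic_cst.
exact: bimeromorphicM IH bimeromorphic_id.
Qed.

(* The remainder c of [p] mod [z - a] satisfies [(z - a) w = c] with [w]
   square-integrable; by Bessel's inequality the Fourier coefficients of [w],
   of constant modulus on each side, vanish, and c = 0. *)
Lemma cancel_unimodular_zero (a : C) (p : {poly C}) (h : C -> C) : `|a| = 1 ->
  h \in Lcirc 2%:E -> ae_eq_circ (fun z => (z - a) * h z) (fun z => p.[z]) ->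
  exists p' : {poly C}, ae_eq_circ h (fun z => p'.[z]).
Proof.
move=> a1 hL e.
have /factor_theorem[p' pE] : root (p - p.[a]%:P) a.
  by rewrite /root hornerD hornerN hornerC subrr.
exists p'; pose w z := h z - p'.[z].
have wL : w \in Lcirc 2%:E.
  have p'L := Lcirc_oo2 (Lcirc_horner p').
  have h21 : (1 <= 2%:E :> \bar R)%E by rewrite lee_fin ler1n.
  have := Lcirc_submod h21 (-1) p'L hL.
  by apply: eq_Lcirc => z; rewrite /w mulN1r addrC.
have ew : ae_eq_circ (fun z => (z - a) * w z) (fun=> p.[a]).
  apply: ae_circ2 (e) (e) => t et _; rewrite /w mulrBr et.
  have := congr1 (fun q : {poly C} => q.[cis t]) pE.
  rewrite hornerD hornerN hornerC hornerM hornerXsubC => h1.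
  by rewrite mulrC -h1 opprB addrCA subrr addr0.
have [pa0 _] := unimodular_pole_cst n0 a1 wL ew.
apply: ae_circ2 ew (ae_neq_unimodular n0 a1) => t ewt ta.
move: ewt; rewrite pa0 => /eqP; rewrite mulf_eq0 subr_eq0 (negbTE ta) /=.
by rewrite subr_eq0 => /eqP.
Qed.

Lemma Lcirc_prod_sub (rs : seq C) :
  (fun z : C => \prod_(r <- rs) (z - r)) \in Lcirc +oo%E.
Proof.
apply: eq_Lcirc (Lcirc_horner (\prod_(r <- rs) ('X - r%:P))) => z.
by rewrite horner_prod; apply: eq_bigr => r _; rewrite hornerXsubC.
Qed.

(** Induction on the roots of the denominator: a unimodular root cancels against the numerator
    because [g] is square-integrable; any other root contributes an invertible factor. *)
Lemma bimeromorphic_quotient (rs : seq C) (p : {poly C}) (g : C -> C) :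
  g \in Lcirc 2%:E ->
  ae_eq_circ (fun z => \prod_(r <- rs) (z - r) * g z) (fun z => p.[z]) ->
  exists m, bimeromorphic m /\ ae_eq_circ g m.
Proof.
elim: rs p g => [|r rs IH] p g gL e.
  exists (fun z => p.[z]); split; first exact: bimeromorphic_horner.
  by apply: ae_circ2 (e) (e) => t; rewrite big_nil mul1r.
have [r1|r1] := eqVneq `|r| 1.
  have hL := Lcirc_mul_oo (or_introl erefl) (Lcirc_prod_sub rs) gL.
  have [|p' ep'] := cancel_unimodular_zero (p := p) r1 hL.
    by apply: ae_circ2 (e) (e) => t; rewrite big_cons mulrA.
  exact: IH gL ep'.
have g'L := Lcirc_mul_oo (or_introl erefl) (Lcirc_sub r) gL.
have [|m [mm gm]] := IH p _ g'L.
  apply: ae_circ2 (e) (e) => t.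
  by rewrite big_cons [(_ - r) * \prod_(_ <- _) _]mulrC -mulrA.
exists (fun z => m z * (z - r)^-1); split.
  exact: bimeromorphicM mm (bimeromorphic_inv r1).
apply: ae_circ2 (gm) (gm) => t <- _; rewrite mulrAC mulfV ?mul1r //.
by rewrite subr_eq0; apply: contra r1 => /eqP <-; rewrite norm_cis.
Qed.

Lemma ae_all_neq (rs : seq C) : {ae circ, forall t, cis t \notin rs}.
Proof.
elim: rs => [|r rs IH]; first by apply/aeW.
have [r1|r1] := eqVneq `|r| 1.
  apply: ae_circ2 IH (ae_neq_unimodular n0 r1) => t h1 h2.
  by rewrite in_cons negb_or h2.
apply: ae_circ2 (IH) (IH) => t h1 _; rewrite in_cons negb_or h1 andbT.
by apply: contra r1 => /eqP <-; rewrite norm_cis.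
Qed.

Lemma rational_bimeromorphic (p q : {poly C}) (g : C -> C) : q != 0 ->
  g \in Lcirc +oo%E -> ae_eq_circ g (fun z => p.[z] / q.[z]) -> bimeromorphic g.
Proof.
move=> q0 gL e; have [rs qE] := closed_field_poly_normal q.
have lq : lead_coef q != 0 by rewrite lead_coef_eq0.
have hq z : q.[z] = lead_coef q * \prod_(r <- rs) (z - r).
  rewrite {1}qE hornerZ horner_prod; congr (_ * _).
  by apply: eq_bigr => r _; rewrite hornerXsubC.
have [|m [[m1 m2] gm]] :=
  @bimeromorphic_quotient rs ((lead_coef q)^-1 *: p) g (Lcirc_oo2 gL).
  (* Roots on the circle form a null set, so the convention for division by zero is harmless. *)
  apply: ae_circ2 e (ae_all_neq rs) => t -> nr.
  have P0 : \prod_(r <- rs) (cis t - r) != 0.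
    rewrite prodf_seq_neq0; apply/allP => r rrs /=; rewrite subr_eq0.
    by apply: contra nr => /eqP ->.
  by rewrite hq hornerZ invfM mulrC -!mulrA mulVf // mulr1 mulrC.
split; first exact: meromorphic_ae m1 gL (ae_circ_sym gm).
apply: meromorphic_ae m2 (Lcirc_conj (leey _) gL) _.
by apply: ae_circ2 (gm) (gm) => t -> _.
Qed.

End RationalMultipliers.

(** * Matrix symbols and matrix units *)

Section MatrixMultipliers.
Variables (R : realType) (n : nat).
Local Notation C := R[i].
Local Notation L2 := (L2 R n).
Local Notation S := (circle_model R n).
Local Notation H := (analytic S).
Local Notation W := (shift_prod S).

Lemma L_mx_sum (I : Type) (r : seq I) (P : I -> C -> 'M[C]_n) :
  (forall i, L_mx +oo%E (P i)) -> L_mx +oo%E (fun z => \sum_(i <- r) P i z).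
Proof.
move=> PL i j.
have := @Lcirc_sumI R +oo%E I r xpredT (fun k z => P k z i j) (leey _) _.
move=> h; apply: eq_Lcirc (h _) => [z|k _]; first by rewrite summxE.
exact: PL.
Qed.

Lemma opM_eq (P Q : C -> 'M[C]_n) F : P =1 Q -> opM P F = opM Q F.
Proof. by move/funext => ->. Qed.

Lemma opM_sum (I : Type) (r : seq I) (P : I -> C -> 'M[C]_n) F :
  (forall i, L_mx +oo%E (P i)) ->
  opM (fun z => \sum_(i <- r) P i z) F = \sum_(i <- r) opM (P i) F.
Proof.
move=> PL; elim: r => [|i r IH].
  rewrite big_nil -[RHS](opM0 F); congr (opM _ F).
  by apply/funext => z; rewrite big_nil.
rewrite big_cons -IH -[X in X + _]scale1r -opMP //; last exact: L_mx_sum.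
by congr (opM _ F); apply/funext => z; rewrite big_cons scale1r.
Qed.

Lemma opM_circ_cst (P : C -> 'M[C]_n) v : L_mx +oo%E P ->
  opM P (circ_cst v) = L2class (fun z => P z *m v).
Proof.
move=> PL; have e : ae_eq_circ (fun z => P z *m L2fun (circ_cst v) z)
    (fun z => P z *m v).
  apply: ae_circ2 (circ_cstE v) (circ_cstE v) => t e1 _; exact: congr1 e1.
apply: L2eqP; apply: ae_circ_trans (opME _ PL) _.
apply: ae_circ_trans e _; apply: ae_circ_sym; apply: L2classE => i.
have := @Lcirc_sum R 2%:E n (fun k z => v k 0 * P z i k) (lee1n 2) _.
move=> h; apply: eq_Lcirc (h _) => [z|k].
  by rewrite mxE; apply: eq_bigr => k _; rewrite mulrC.
apply: Lcirc_mul_oo; [by left | exact: Lcirc_cst (leey _) |].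
exact: Lcirc_oo2.
Qed.

Lemma opM_cst_analytic (A : 'M[C]_n) F : H F -> H (opM (fun=> A) F).
Proof.
move=> hF k c; have AL := L_mx_cst A.
have -> : iter k.+1 (shift S) (opM (fun=> A) F) =
    opM (fun=> A) (iter k.+1 (shift S) F).
  by elim: k.+1 => // j IH; rewrite !iterS IH opM_shift.
transitivity (L2ip (iter k.+1 (shift S) F) (cst_of S (adjmx A *m c))).
  transitivity (L2ip (iter k.+1 (shift S) F)
      (opM (fun=> adjmx A) (circ_cst c))); first exact: opM_adj.
  by congr (L2ip _ _); exact: opM_circ_cst c (L_mx_cst (adjmx A)).
exact: hF.
Qed.

Definition matrix_unit (i j : 'I_n) : L2 -> L2 := opM (fun=> delta_mx i j).

Lemma sum_matrix_unit F : \sum_i matrix_unit i i F = F.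
Proof.
rewrite -opM_sum; last by move=> i; exact: L_mx_cst.
rewrite -[RHS]opM1; congr (opM _ F); apply/funext => z.
by rewrite -mx1_sum_delta.
Qed.

Lemma adjmxE (A : 'M[C]_n) i j : adjmx A i j = (A j i)^*.
Proof. by rewrite /adjmx !mxE. Qed.

Lemma adjmxK (A : 'M[C]_n) : adjmx (adjmx A) = A.
Proof. by apply/matrixP => i j; rewrite !adjmxE conjCK. Qed.

Lemma adjmx_mul_unit (A : 'M[C]_n) i j :
  adjmx (A *m delta_mx j i) *m (A *m delta_mx j i) =
  (adjmx A *m A) j j *: delta_mx i i.
Proof.
have AE k l : (A *m delta_mx j i) k l = A k j * (l == i)%:R.
  rewrite mxE (bigD1 j) //= mxE eqxx big1 ?addr0 // => m mj.
  by rewrite mxE (negbTE mj) mulr0.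
apply/matrixP => k l; rewrite [LHS]mxE [RHS]mxE [X in _ = X * _]mxE mulr_suml.
apply: eq_bigr => m _; rewrite !adjmxE !AE mxE rmorphM.
by case: (k == i); case: (l == i);
  rewrite /= ?rmorph1 ?rmorph0 ?mulr1 ?mulr0 ?mul0r.
Qed.

(** The sum over j of the squared norms of P E_ji F is the integral of the trace of adj(P) P times
    the squared modulus of the i-th component of F, and this trace is unchanged when P and adj(P)
    are exchanged. *)
Lemma matrix_unit_trace (P : C -> 'M[C]_n) i F : L_mx +oo%E P ->
  \sum_j (L2ip (opM P (matrix_unit j i F)) (opM P (matrix_unit j i F)) -
    L2ip (opM (fun z => adjmx (P z)) (matrix_unit j i F))
      (opM (fun z => adjmx (P z)) (matrix_unit j i F))) = 0.
Proof.
move=> PL; have PL' := L_mx_adj PL.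
have key (Q : C -> 'M[C]_n) j : L_mx +oo%E Q ->
    L2ip (opM Q (matrix_unit j i F)) (opM Q (matrix_unit j i F)) =
    L2ip F (opM (fun z => (adjmx (Q z) *m Q z) j j *: delta_mx i i) F).
  move=> QL; have dL := L_mx_cst (delta_mx j i : 'M[C]_n).
  rewrite /matrix_unit opM_comp // opM_adj; last exact: L_mxM.
  rewrite opM_comp; [|exact: L_mx_adj (L_mxM QL dL)|exact: L_mxM].
  apply: (congr1 (L2ip F)); apply: opM_eq => z; exact: adjmx_mul_unit.
pose X (Q : C -> 'M[C]_n) j z : 'M[C]_n := (adjmx (Q z) *m Q z) j j *: delta_mx i i.
have XL (Q : C -> 'M[C]_n) j : L_mx +oo%E Q -> L_mx +oo%E (X Q j).
  move=> QL k l; have := Lcirc_mul_oo (or_intror erefl)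
    (L_mxM (L_mx_adj QL) QL j j) (L_mx_cst (delta_mx i i : 'M[C]_n) k l).
  by apply: eq_Lcirc => z; rewrite [RHS]mxE.
have tr (Q : C -> 'M[C]_n) : L_mx +oo%E Q -> \sum_j L2ip F (opM (X Q j) F) =
    L2ip F (opM (fun z => \tr (adjmx (Q z) *m Q z) *: delta_mx i i) F).
  move=> QL; transitivity (L2ip F (\sum_j opM (X Q j) F)).
    exact: (esym (linear_sumr (@L2ip R n) F _ _ _)).
  rewrite -opM_sum; last by move=> j; exact: XL.
  apply: (congr1 (L2ip F)); apply: opM_eq => z.
  by rewrite /X -scaler_suml.
transitivity (\sum_j L2ip F (opM (X P j) F) -
    \sum_j L2ip F (opM (X (fun z => adjmx (P z)) j) F)).
  by rewrite -sumrB; apply: eq_bigr => j _; rewrite !key.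
apply/eqP; rewrite subr_eq0; apply/eqP.
apply: (etrans (tr P PL)); apply: (etrans _ (esym (tr _ PL'))).
apply: (congr1 (L2ip F)); apply: opM_eq => z.
by rewrite adjmxK mxtrace_mulC.
Qed.

(** Expansion in matrix units; the polynomials clearing the entries are multiplied together. *)
Lemma meromorphic_mx (P : C -> 'M[C]_n) : L_mx +oo%E P ->
  (forall i j, meromorphic n (fun z => P z i j)) ->
  exists s, (forall a, a \in s -> `|a| < 1) /\
    forall F, H F -> H (W s (opM P F)).
Proof.
move=> PL hP.
pose T (p : 'I_n * 'I_n) z := P z p.1 p.2 *: delta_mx p.1 p.2 : 'M[C]_n.
have TE p F : opM (T p) F = opS (fun z => P z p.1 p.2) (matrix_unit p.1 p.2 F).
  rewrite /opS /matrix_unit opM_comp; [|exact: L_mx_scalar|exact: L_mx_cst].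
  by congr (opM _ F); apply/funext => z; rewrite mul_scalar_mx.
have TL p : L_mx +oo%E (T p).
  move=> i j; have := Lcirc_mul_oo (or_intror erefl) (PL p.1 p.2)
    (L_mx_cst (delta_mx p.1 p.2 : 'M[C]_n) i j).
  by apply: eq_Lcirc => z; rewrite [RHS]mxE.
have PE : P = (fun z => \sum_p T p z).
  apply/funext => z; rewrite [LHS]matrix_sum_delta pair_big; exact: eq_bigr.
have : exists s, (forall a, a \in s -> `|a| < 1) /\
    forall F, H F -> H (W s (\sum_p opM (T p) F)).
  elim: (index_enum _) => [|p r [s [s1 hs]]].
    exists [::]; split => // F hF; rewrite big_nil; exact: analytic0.
  have [_ [s' [s1' hs']]] := hP p.1 p.2.
  exists (s ++ s'); split => [a|F hF].
    by rewrite mem_cat => /orP[/s1|/s1'].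
  rewrite big_cons shift_prodD; apply: analyticD.
    rewrite shift_prod_cat; apply: analytic_shift_prod; rewrite TE; apply: hs'.
    exact: opM_cst_analytic.
  rewrite shift_prod_cat shift_prodC; apply: analytic_shift_prod; exact: hs.
case=> s [s1 hs]; exists s; split => // F hF.
by rewrite PE opM_sum //; exact: hs.
Qed.

End MatrixMultipliers.

(** * Toeplitz operators with rational symbols *)

Section RationalToeplitz.
Variables (R : realType) (n : nat).
Local Notation C := R[i].
Local Notation L2 := (L2 R n).
Local Notation H2 := (H2 R n).
Local Notation S := (circle_model R n).
Local Notation Z := (shift S).
Local Notation H := (analytic S).
Local Notation W := (shift_prod S).
Local Notation D := (shift_sub S).
Local Notation kap := (cst_of S).

Lemma H2val_analytic (x : H2) : H (H2val x).
Proof. by apply/analytic_hardyP; case: x. Qed.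

Lemma analytic_H2val F : H F -> exists x : H2, F = H2val x.
Proof. by move/analytic_hardyP => hF; exists (MkH2 hF). Qed.

(** An explicit decomposition ensures that [hardy_proj] is the projection and not the default value
    0 of [xget]. *)
Lemma hardy_projP F : (exists h r, [/\ H h, coanalytic S r & F = h + r]) ->
  coanalytic S (F - H2val (hardy_proj F)).
Proof.
case=> h [r [hh hr e]]; have [x hx] := analytic_H2val hh.
have ex : exists G : H2,
    [set G | forall K : H2, L2ip (F - H2val G) (H2val K) = 0]%classic G.
  exists x => K; rewrite e -hx [h + r]addrC addrK.
  by apply: hr; exact: H2val_analytic.
have := xgetPex 0 ex; rewrite -/(hardy_proj F) /= => hp K hK.
by have [y ->] := analytic_H2val hK; exact: hp.
Qed.

Lemma toeplitzE (Phi : C -> 'M[C]_n) x :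
  toeplitz Phi x = hardy_proj (opM Phi (H2val x)).
Proof. by rewrite opM_unlock. Qed.

Lemma shift_prod_opS s F :
  W s F = opS (fun z => \prod_(a <- s) (z - a)) F.
Proof.
elim: s => [|a s IH].
  rewrite /= -[LHS]scale1r -opS_cst; apply: opM_eq => z.
  by rewrite big_nil.
rewrite /= IH shift_subE; apply: etrans (circ_shift_subE _ _) _.
rewrite opS_comp; [|exact: Lcirc_sub|exact: Lcirc_prod_sub].
by apply: opM_eq => z; rewrite big_cons.
Qed.

Lemma Lcirc_prod_one_sub (s : seq C) :
  (fun z : C => \prod_(a <- s) (1 - a^* * z)) \in Lcirc +oo%E.
Proof.
elim: s => [|a s IH].
  by apply: eq_Lcirc (Lcirc_cst 1 (leey _)) => z; rewrite big_nil.
have h : (fun z : C => 1 - a^* * z) \in Lcirc +oo%E.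
  have := Lcirc_submod (leey _) (- a^*) (Lcirc_id R) (Lcirc_cst 1 (leey _)).
  by apply: eq_Lcirc => z; rewrite mulNr addrC.
have := Lcirc_mul_oo (or_intror erefl) h IH.
by apply: eq_Lcirc => z; rewrite big_cons.
Qed.

Lemma opS_prod_one_sub_cons a s F :
  opS (fun z => \prod_(b <- a :: s) (1 - b^* * z)) F =
  opS (fun z => \prod_(b <- s) (1 - b^* * z)) F -
    a^* *: Z (opS (fun z => \prod_(b <- s) (1 - b^* * z)) F).
Proof.
have PL := Lcirc_prod_one_sub s; set m := fun z => \prod_(b <- s) _ in PL *.
have ZE : Z (opS m F) = opS (fun z => z * m z) F.
  exact: opS_comp (Lcirc_id R) PL.
have zmL := Lcirc_mul_oo (or_intror erefl) (Lcirc_id R) PL.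
rewrite ZE -scaleNr [RHS]addrC -opSP //; apply: opM_eq => z.
by rewrite big_cons mulrBl mul1r mulNr mulrA addrC.
Qed.

(* The value at [a] of the holomorphic extension of [F] is [v]. *)
Definition holval a F v := exists G, H G /\ F = kap v + D a G.

Lemma holvalP a b F v G w : holval a F v -> holval a G w ->
  holval a (b *: F + G) (b *: v + w).
Proof.
move=> [F' [hF' ->]] [G' [hG' ->]]; exists (b *: F' + G'); split.
  exact: analyticP.
by rewrite !linearP scalerDr addrACA.
Qed.

Lemma holval_analytic a F v : holval a F v -> H F.
Proof.
case=> G [hG ->]; apply: analyticD; first exact: analytic_cst.
exact: analytic_shift_sub.
Qed.

Lemma holval_shift a F v : holval a F v -> holval a (Z F) (a *: v).
Proof.
move=> hv; have hF := holval_analytic hv; case: hv => G [hG e].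
exists (F + a *: G); split; first by apply: analyticD => //; exact: analyticZ.
rewrite (shiftE S a F) shift_subD shift_subZ {2}e scalerDr [kap (_ *: _)]linearZ.
by rewrite addrCA.
Qed.

Lemma holval_prod_one_sub a s F v : holval a F v ->
  holval a (opS (fun z => \prod_(b <- s) (1 - b^* * z)) F)
    ((\prod_(b <- s) (1 - b^* * a)) *: v).
Proof.
move=> hv; elim: s => [|b s IH].
  rewrite big_nil scale1r.
  have -> // : opS (fun z => \prod_(b <- [::]) (1 - b^* * z)) F = F.
  rewrite -[RHS]scale1r -opS_cst; apply: opM_eq => z.
  by rewrite big_nil.
rewrite opS_prod_one_sub_cons big_cons mulrBl mul1r scalerBl.
rewrite -mulrA -!scalerA -!scaleNr ![_ + - _ *: _]addrC.
by apply: holvalP => //; exact: holval_shift.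
Qed.

Lemma opS_prod_one_sub_analytic s F : H F ->
  H (opS (fun z => \prod_(b <- s) (1 - b^* * z)) F).
Proof.
have z1 : `|0 : C| < 1 by rewrite normr0 ltr01.
move=> hF; have [v [G [hG e]]] := analytic_div z1 hF.
have hv : holval 0 F v by exists G.
exact: holval_analytic (holval_prod_one_sub s hv).
Qed.

Lemma hardy_colE (B : C -> 'M[C]_n) j : hardy_mx 2%:E B ->
  ae_eq_circ (L2fun (L2class (fun z => col j (B z)))) (fun z => col j (B z)).
Proof.
move=> hB; apply: L2classE => i; have /andP[h _] := hB i j.
by apply: eq_Lcirc h => z; rewrite mxE.
Qed.

Lemma hardy_col_analytic (B : C -> 'M[C]_n) j : hardy_mx 2%:E B ->
  H (L2class (fun z => col j (B z))).
Proof.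
move=> hB; apply/analytic_hardyP/forallP => i; apply/andP.
split; first exact: L2fun_L2.
have /andP[BL /asboolP B0] := hB i j; apply/asboolP => -[//|k] k0.
rewrite -(B0 _ k0); apply: circ_int_ae.
- apply: Lcirc_mul; first exact: L2fun_L2.
  by rewrite NegzE opprK; exact: Lcirc_exp (lee1n 2).
- apply: Lcirc_mul => //.
  by rewrite NegzE opprK; exact: Lcirc_exp (lee1n 2).
apply: ae_circ2 (hardy_colE j hB) (hardy_colE j hB) => t e _; congr (_ * _).
by have := congr1 (fun v : 'cV[C]_n => v i 0) e; rewrite mxE.
Qed.

(** On the circle 1/(1 - a/z) = z/(z - a), so the Cauchy integral in [hardy_eval] is the coefficient
    given by [analytic_valE]. *)
Lemma hardy_eval_holval (B : C -> 'M[C]_n) a j : `|a| < 1 ->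
  hardy_mx 2%:E B ->
  holval a (L2class (fun z => col j (B z))) (col j (hardy_eval B a)).
Proof.
move=> a1 hB; pose F : L2 := L2class (fun z => col j (B z)).
have FE : ae_eq_circ (L2fun F) (fun z => col j (B z)) by exact: hardy_colE.
have hF : H F by exact: hardy_col_analytic.
have [v [G [hG e]]] := analytic_div a1 hF.
exists G; split => //; rewrite -/F [LHS]e; congr (kap _ + _).
apply/colP => i; rewrite !mxE.
have kv : L2ip (kap v) (kap (delta_mx i 0)) = v i 0 by exact: cst_of_dot_delta.
rewrite -kv; apply: etrans (esym (analytic_valE (delta_mx i 0) a1 hG e)) _.
have iL := Lcirc_inv_sub (lt1_neq1 a1).
have ziL := Lcirc_mul_oo (or_intror erefl) (Lcirc_id R) iL.
have -> : Z (resolvent S a F) = opS (fun z => z * (z - a)^-1) F.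
  exact: opS_comp (Lcirc_id R) iL.
apply: etrans (L2ip_opS_delta F i ziL) _.
have /andP[BL _] := hB i j.
have on t : cis t * (cis t - a)^-1 * B (cis t) i j =
    B (cis t) i j / (1 - a / cis t).
  have c0 : (cis t : C) != 0 by rewrite -normr_eq0 norm_cis oner_eq0.
  rewrite mulrC; congr (_ * _).
  by rewrite -[X in X - _ / _](mulfV c0) -mulrBl invfM invrK mulrC.
apply: circ_int_ae.
- apply: Lcirc21; apply: Lcirc_mul_oo; [by left | exact: ziL | exact: L2fun_L2].
- exact: Lcirc_on_circle on (Lcirc21 (Lcirc_mul_oo (or_introl erefl) ziL BL)).
apply: ae_circ2 (FE) (FE) => t et _; rewrite -on; congr (_ * _).
by have := congr1 (fun v : 'cV[C]_n => v i 0) et; rewrite mxE.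
Qed.

Lemma holval_sum a (F : 'I_n -> L2) (v : 'I_n -> 'cV[C]_n) (x : 'cV[C]_n) :
  (forall j, holval a (F j) (v j)) ->
  holval a (\sum_j x j 0 *: F j) (\sum_j x j 0 *: v j).
Proof.
move=> h; apply: (big_ind2 (fun G w => holval a G w)) => [|G w G' w' hG hG'|j _].
- exists 0; split; first exact: analytic0.
  by rewrite [kap 0]linear0 [D a 0]linear0 addr0.
- by rewrite -[G]scale1r -[w]scale1r; exact: holvalP.
rewrite -[_ *: F j]addr0 -[_ *: v j]addr0; apply: holvalP => //.
exists 0; split; first exact: analytic0.
by rewrite [kap 0]linear0 [D a 0]linear0 addr0.
Qed.

Lemma cst_of_sum (M : {linear L2 -> L2}) (x : 'cV[C]_n) :
  M (kap x) = \sum_j x j 0 *: M (kap (delta_mx j 0)).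
Proof.
rewrite {1}[x]matrix_sum_delta; under eq_bigr do rewrite big_ord1.
rewrite [kap _]linear_sum linear_sum; apply: eq_bigr => j _ /=.
by rewrite [circ_cst _]linearZ linearZ.
Qed.

(** A Blaschke factor is unimodular on the circle, so its conjugate is its inverse (1 - conj(a)
    z)/(z - a). *)
Lemma blaschke_conj (s : seq C) t : (forall a, a \in s -> `|a| < 1) ->
  \prod_(a <- s) (cis t - a) *
    (\prod_(a <- s) ((cis t - a) / (1 - a^* * cis t)))^* =
  \prod_(a <- s) (1 - a^* * cis t).
Proof.
have c0 : (cis t : C) != 0 by rewrite -normr_eq0 norm_cis oner_eq0.
elim: s => [_|a s IH s1]; first by rewrite !big_nil mul1r conjC1.
have a1 : `|a| < 1 by rewrite s1 // mem_head.
have ta : cis t - a != 0.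
  rewrite subr_eq0; apply/eqP => e; move: a1.
  by rewrite -e norm_cis ltxx.
rewrite !big_cons rmorphM /= mulrACA IH; last first.
  by move=> b bs; rewrite s1 // in_cons bs orbT.
congr (_ * _); rewrite rmorphM fmorphV !rmorphB rmorphM /= conjC1 conjCK conj_cis.
have -> : 1 - a * (cis t)^-1 = (cis t - a) / cis t by rewrite mulrBl mulfV.
have -> : (cis t)^-1 - a^* = (1 - a^* * cis t) / cis t.
  by rewrite mulrBl mul1r mulfK.
rewrite invfM invrK mulrACA mulVf // mulr1.
by rewrite mulrCA mulfV // mulr1.
Qed.

End RationalToeplitz.

(** * Columns of the symbol and the dichotomy *)

Section ToeplitzDichotomy.
Variables (R : realType) (n : nat).
Local Notation C := R[i].
Local Notation L2 := (L2 R n).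
Local Notation H2 := (H2 R n).
Local Notation S := (circle_model R n).
Local Notation H := (analytic S).
Local Notation W := (shift_prod S).

Lemma minus_part_col (Phi B : C -> 'M[C]_n) (theta : C -> C) j :
  L_mx +oo%E Phi ->
  ae_eq_circ (minus_part Phi) (fun z => adjmx (B z) *m (theta z)%:M) ->
  let F : L2 := L2class (fun z => col j (Phi z)) in
  ae_eq_circ (L2fun (F - H2val (hardy_proj F)))
    (fun z => (theta z)^* *: col j (B z)).
Proof.
move=> PL e F; apply: ae_circ2 (e) (e) => t et _; apply/colP => i.
have := congr1 (fun A : 'M[C]_n => (A j i)^*) et.
rewrite /minus_part adjmxE mxE conjCK => ->.
by rewrite mul_mx_scalar [in LHS]mxE adjmxE rmorphM /= conjCK [RHS]mxE [in RHS]mxE.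
Qed.

Lemma shift_prod_blaschke (s : seq C) (c : C) (theta : C -> C)
    (B : C -> 'cV[C]_n) (F : L2) : (forall a, a \in s -> `|a| < 1) ->
  (forall t, theta (cis t) =
    c * \prod_(a <- s) ((cis t - a) / (1 - a^* * cis t))) ->
  ae_eq_circ (L2fun (L2class B)) B ->
  ae_eq_circ (L2fun F) (fun z => (theta z)^* *: B z) ->
  W s F = c^* *: opS (fun z => \prod_(a <- s) (1 - a^* * z)) (L2class B).
Proof.
move=> s1 thE BE FE; rewrite shift_prod_opS -opS_cst.
have PL := Lcirc_prod_one_sub s; have QL := Lcirc_prod_sub s.
have cL : (fun=> c^*) \in Lcirc +oo%E by exact: Lcirc_cst (leey _).
rewrite opS_comp //; have cPL := Lcirc_mul_oo (or_intror erefl) cL PL.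
apply: L2eqP; apply: ae_circ_trans (opME _ (L_mx_scalar QL)) _.
apply: ae_circ_trans (ae_circ_sym (opME _ (L_mx_scalar cPL))).
apply: ae_circ2 FE BE => t e1 e2; rewrite !mul_scalar_mx.
apply: etrans (congr1 _ e1) (esym (etrans (congr1 _ e2) _)).
rewrite scalerA; congr (_ *: _); rewrite thE rmorphM mulrCA.
by congr (_ * _); exact: esym (blaschke_conj _ s1).
Qed.

Definition H2incl : {linear H2 -> L2} :=
  HB.pack (@H2val R n : H2 -> L2)
    (GRing.isLinear.Build C H2 L2 *:%R (@H2val R n) (fun _ _ _ => erefl)).

Lemma toeplitz_coanalytic (Phi : C -> 'M[C]_n) s : L_mx +oo%E Phi ->
  (forall a, a \in s -> `|a| < 1) -> (forall F, H F -> H (W s (opM Phi F))) ->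
  forall x : H2, coanalytic S (opM Phi (H2val x) - H2val (toeplitz Phi x)).
Proof.
move=> PL s1 hs x; rewrite toeplitzE; apply: hardy_projP.
exact: projection_exists s1 (hs _ (H2val_analytic x)).
Qed.

Lemma analytic_cols_hardy_mx (Phi : C -> 'M[C]_n) : L_mx +oo%E Phi ->
  (forall j, H (L2class (fun z => col j (Phi z)))) -> hardy_mx +oo%E Phi.
Proof.
move=> PL hP i j; apply/andP; split; first exact: PL.
pose F : L2 := L2class (fun z => col j (Phi z)).
have FE : ae_eq_circ (L2fun F) (fun z => col j (Phi z)).
  apply: L2classE => k; apply: eq_Lcirc (Lcirc_oo2 (PL k j)) => z.
  by rewrite mxE.
have /analytic_hardyP/forallP/(_ i)/andP[_ /asboolP F0] := hP j.
apply/asboolP => -[//|k] k0; rewrite -(F0 _ k0); apply: circ_int_ae.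
- apply: Lcirc_mul; first exact: Lcirc_oo2.
  by rewrite NegzE opprK; exact: Lcirc_exp (lee1n 2).
- apply: Lcirc_mul; first exact: L2fun_L2.
  by rewrite NegzE opprK; exact: Lcirc_exp (lee1n 2).
apply: ae_circ2 (FE) (FE) => t e _; congr (_ * _).
by have := congr1 (fun v : 'cV[C]_n => v i 0) e; rewrite mxE.
Qed.

Lemma sum_scale_col (A : 'M[C]_n) (x : 'cV[C]_n) u :
  \sum_j x j 0 *: (u *: col j A) = u *: (A *m x).
Proof.
apply/colP => i; rewrite summxE !mxE mulr_sumr; apply: eq_bigr => j _.
by rewrite !mxE mulrCA [x j 0 * _]mulrC.
Qed.

End ToeplitzDichotomy.

Theorem corollary3p9 (R : realType) (n : nat) (Phi B : R[i] -> 'M[R[i]]_n)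
    (theta : R[i] -> R[i]) :
  (0 < n)%N ->
  L_mx +oo%E Phi ->
  rational_mx Phi ->
  finite_blaschke theta ->
  hardy_mx 2%:E B ->
  ae_eq_circ (minus_part Phi) (fun z => adjmx (B z) *m (theta z)%:M) ->
  (forall alpha : R[i], `|alpha| < 1 -> theta alpha = 0 ->
     hardy_eval B alpha \in unitmx) ->
  subnormal_operator (@H2ip R n) (toeplitz Phi) ->
  normal_operator (@H2ip R n) (toeplitz Phi) \/ hardy_mx +oo%E Phi.
Proof.
move=> n0 PL ratP [c [s [c1 s1 thE]]] hB minusE unitB subT.
pose S := circle_model R n.
have PL' := L_mx_adj PL.
pose M := opM_lin PL; pose M' := opM_lin PL'.
have bim i j : bimeromorphic n (fun z => Phi z i j).
  have [p [q [q0 e]]] := ratP i j.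
  exact: rational_bimeromorphic q0 (PL i j) e.
have [s2 [s2_disc hs2]] := meromorphic_mx PL (fun i j => (bim i j).1).
have [s' [s'_disc hs']] : exists s', (forall a, a \in s' -> `|a| < 1) /\
    forall F, analytic S F -> analytic S (shift_prod S s' (M' F)).
  apply: (meromorphic_mx PL') => i j.
  by apply: meromorphic_on_circle (bim j i).2 _ => t; rewrite adjmxE.
pose co j : L2 R n := L2class (fun z => col j (B z)).
pose h j := hardy_proj (L2class (fun z => col j (Phi z))).
pose V := opS (n := n) (fun z => \prod_(a <- s) (1 - a^* * z)).
have M_col j : M (cst_of S (delta_mx j 0)) = L2class (fun z => col j (Phi z)).
  apply: etrans (opM_circ_cst _ PL) _; congr L2class.
  by apply/funext => z; rewrite colE.
(* Column j of Phi is conj(theta) times column j of B plus an analytic part; multiplying by t turns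
   conj(theta) into conj(c) times the product of the 1 - conj(a) z. *)
have WM j : shift_prod S s (M (cst_of S (delta_mx j 0))) =
    c^* *: V (co j) + shift_prod S s (H2val (h j)).
  have thE' t : theta (cis t) =
      c * \prod_(a <- s) ((cis t - a) / (1 - a^* * cis t)).
    by rewrite thE // norm_cis.
  rewrite -(shift_prod_blaschke s1 thE' (hardy_colE j hB)
    (minus_part_col j PL minusE)).
  by rewrite -shift_prodD subrK M_col.
have WM_analytic j : analytic S (shift_prod S s (M (cst_of S (delta_mx j 0)))).
  rewrite WM; apply: analyticP.
    by apply: opS_prod_one_sub_analytic; exact: hardy_col_analytic.
  by apply: analytic_shift_prod; exact: H2val_analytic.
have MZ F : M (shift S F) = shift S (M F) by exact: opM_shift.
have M'Z F : M' (shift S F) = shift S (M' F) by exact: opM_shift.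
case: (s =P [::]) => [s0|/eqP s0].
  right; apply: analytic_cols_hardy_mx => // j.
  by rewrite -M_col; have := WM_analytic j; rewrite s0.
left.
have [a0 a0s] : exists a, a \in s.
  by case: (s) s0 => // a l _; exists a; rewrite mem_head.
pose N := [the {linear L2 R n -> L2 R n} of shift_prod S s \o M].
have NE F : N F = shift_prod S s (M F) by [].
have M_analytic F : analytic S F -> analytic S (shift_prod S s (M F)).
  (* Rationality gives some clearing polynomial [s2]; analyticity of t Phi on constants then shows
     that t alone clears [M]. *)
  apply: (multiplier_analytic (M := N) (s := s2)) => {F}.
  - by move=> F; rewrite !NE MZ shift_prod_shift.
  - exact: s2_disc.
  - move=> F hF; rewrite NE shift_prodC.
    by apply: analytic_shift_prod; exact: hs2.
  move=> v; rewrite cst_of_sum; apply: big_ind => [||j _].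
  - exact: analytic0.
  - by move=> F G; exact: analyticD.
  - by apply: analyticZ; exact: WM_analytic.
have M_val a v : a \in s -> exists v' G, analytic S G /\
    shift_prod S s (M (cst_of S v')) = cst_of S v + shift_sub S a G.
  move=> as_; have a1 := s1 a as_.
  have Bu : hardy_eval B a \in unitmx.
    apply: unitB => //; rewrite thE ?ltW // (big_rem a) //=.
    by rewrite subrr !mul0r mulr0.
  (* The value of t Phi at [a] is u B(a): the term t h vanishes there, since [a] is a zero of t. *)
  pose u := c^* * \prod_(b <- s) (1 - b^* * a).
  have c0 : c != 0 by rewrite -normr_eq0 c1 oner_eq0.
  have P0 : \prod_(b <- s) (1 - b^* * a) != 0.
    rewrite prodf_seq_neq0; apply/allP => b bs /=; rewrite subr_eq0.
    apply/eqP => e; have : `|b^* * a| < 1.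
      by rewrite normrM norm_conjC; apply: mulr_ilt1 => //; exact: s1.
    by rewrite -e normr1 ltxx.
  have u0 : u != 0 by apply: mulf_neq0 P0; rewrite fmorph_eq0.
  have hv j : holval a (shift_prod S s (M (cst_of S (delta_mx j 0))))
      (u *: col j (hardy_eval B a)).
    rewrite WM -scalerA -[X in holval a _ X]addr0; apply: holvalP.
      by apply: holval_prod_one_sub; exact: hardy_eval_holval.
    exists (shift_prod S (rem a s) (H2val (h j))); split.
      by apply: analytic_shift_prod; exact: H2val_analytic.
    by rewrite [cst_of S 0]linear0 add0r -shift_prod_rem.
  (* The solution of u B(a) v' = v. *)
  pose v' := u^-1 *: (invmx (hardy_eval B a) *m v).
  have [G [hG e]] := holval_sum v' hv.
  exists v', G; split => //; rewrite -NE (cst_of_sum N) e; congr (cst_of S _ + _).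
  by rewrite sum_scale_col /v' -scalemxAr scalerA mulfV // scale1r mulKVmx.
apply: (@compression_normal R n (L2 R n) (@L2ip R n) S M M' (@matrix_unit R n)
  s s' a0 (H2 R n) (@H2ip R n) (H2incl R n) (toeplitz Phi)
  (toeplitz (fun z => adjmx (Phi z)))).
- exact: MZ.
- exact: M'Z.
- by move=> F G; exact: opM_adj.
- by move=> i j F; exact: opM_cst_analytic.
- exact: sum_matrix_unit.
- by move=> i F; exact: matrix_unit_trace.
- exact: s1.
- exact: s'_disc.
- exact: a0s.
- exact: hs'.
- exact: M_analytic.
- by move=> a v; exact: M_val.
- exact: H2val_analytic.
- exact: analytic_H2val.
- by [].
- exact: toeplitz_coanalytic s1 M_analytic.
- exact: toeplitz_coanalytic s'_disc hs'.
exact: subT.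
Qed.
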